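(* For all $*$-infinitely divisible probability measures $\mu,\nu$ on $\mathbb{R}$ and all integers $d\ge1$, $$\mathbb{P}_d^{\mu*\nu}=\mathbb{P}_d^{\mu}*\mathbb{P}_d^{\nu}\qquad\text{and}\qquad \mathbb{L}_d^{\mu*\nu}=\mathbb{L}_d^{\mu}*\mathbb{L}_d^{\nu}.$$
   Context: A probability measure $\mu$ on $\mathbb{R}$ is $*$-infinitely divisible if for every $n\ge1$ there is a probability measure $\mu_n$ with $\mu_n^{*n}=\mu$; $*$ is classical convolution (on spaces of matrices, convolution with respect to matrix addition). The distributions $\mathbb{P}_d^\mu$ and $\mathbb{L}_d^\mu$ are defined as follows. Let $(\mu_n)$ be probability measures on $\mathbb{R}$ and $(k_n)$ integers tending to infinity with $\mu_n^{*k_n}\to\mu$ weakly. $\mathbb{P}_d^\mu$ (resp. $\mathbb{L}_d^\mu$) is the weak limit as $n\to\infty$ of the law of the sum of $k_n$ independent copies of $U\,\mathrm{diag}(X_{n,1},\ldots,X_{n,d})U^*$ (resp. $U\,\mathrm{diag}(X_{n,1},\ldots,X_{n,d})V$), where $U,V$ are independent Haar-distributed $d\times d$ unitary matrices, independent of the i.i.d. $\mu_n$-distributed $X_{n,1},\ldots,X_{n,d}$. The limits exist, do not depend on the choice of $(\mu_n),(k_n)$, and have Fourier transforms $\int e^{i\mathrm{Tr}AM}\,d\mathbb{P}_d^\mu(M)=\exp(\mathbb{E}(d\,\psi_\mu(\langle u,Au\rangle)))$ for all Hermitian $A$, and $\int e^{i\Re\mathrm{Tr}A^*M}\,d\mathbb{L}_d^\mu(M)=\exp(\mathbb{E}(d\,\psi_\mu(\Re\langle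 u,Av\rangle)))$ for all complex $A$, where $u,v$ are independent and uniform on the unit sphere of $\mathbb{C}^d$ and $\psi_\mu$ is the Lévy exponent of $\mu$, i.e. the unique continuous $f:\mathbb{R}\to\mathbb{C}$ with $f(0)=0$ and $\widehat\mu=\exp\circ f$. *)

(* Defs.v *)
From HB Require Import structures.
From mathcomp Require Import all_boot all_order all_algebra.
From mathcomp Require Import complex.
From mathcomp Require Import all_classical all_reals all_analysis.
From mathcomp Require Import measurable_realfun giry ring lra.

Set Implicit Arguments.
Unset Strict Implicit.
Unset Printing Implicit Defensive.

Import Order.TTheory GRing.Theory Num.Theory.
Import numFieldTopology.Exports numFieldNormedType.Exports.

Local Open Scope classical_set_scope.
Local Open Scope ring_scope.
Local Open Scope complex_scope.
Local Open Scope sesquilinear_scope.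

HB.mixin Record isBorel (d : measure_display) T
    of Measurable d T & Topological T := {
  measurable_borelE : @measurable d T = <<s @open T >> }.

#[short(type="borelType")]
HB.structure Definition Borel (d : measure_display) :=
  { T of isBorel d T & Measurable d T & Topological T }.

Section real_borel.
Variable R : realType.

Let measurable_borelR : @measurable _ R = <<s @open R >>.
Proof.
rewrite eqEsubset; split.
  rewrite [X in X `<=` _](RGenOpens.measurableE R).
  apply: smallest_sub; first exact: smallest_sigma_algebra.
  move=> A [x [y ->]]; apply: sub_sigma_algebra; exact: interval_open.
apply: smallest_sub => [|A oA]; first exact: sigma_algebra_measurable.
exact: open_measurable.
Qed.

HB.instance Definition _ := isBorel.Build _ R measurable_borelR.
End real_borel.

(* The usual topology of the complex numbers, given by the modulus. *)
Section complex_topology.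
Variable R : realType.
HB.instance Definition _ := NormedModule.copy R[i] R[i]^o.
End complex_topology.

Definition cmx_display : measure_display.
Proof. exact: default_measure_display. Qed.

Section complex_matrix_borel.
Variables (R : realType) (n : nat).

HB.instance Definition _ := @isMeasurable.Build cmx_display 'M[R[i]]_n
  <<s @open 'M[R[i]]_n >> (@sigma_algebra0 _ _ _) (@sigma_algebraC _ _)
  (@sigma_algebra_bigcup _ _ _).
HB.instance Definition _ := isBorel.Build cmx_display 'M[R[i]]_n erefl.
End complex_matrix_borel.

Section complex_measurability.
Context {R : realType} {d : measure_display} {T : measurableType d}.

Definition cmeasurable (f : T -> R[i]) :=
  measurable_fun [set: T] (@complex.Re R \o f) /\ measurable_fun [set: T] (@complex.Im R \o f).

Lemma cmeasurable_real (f : T -> R) :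
  measurable_fun [set: T] f -> cmeasurable (fun x => (f x)%:C).
Proof. by move=> mf; split => //=; exact: measurable_cst. Qed.

Lemma cmeasurable_cst (c : R[i]) : cmeasurable (fun=> c).
Proof. by split; exact: measurable_cst. Qed.

Lemma cmeasurableD f g :
  cmeasurable f -> cmeasurable g -> cmeasurable (fun x => f x + g x).
Proof.
move=> [f1 f2] [g1 g2]; split.
  have := measurable_funD f1 g1; apply: eq_measurable_fun => x _ /=.
  by case: (f x) (g x) => ? ? [].
have := measurable_funD f2 g2; apply: eq_measurable_fun => x _ /=.
by case: (f x) (g x) => ? ? [].
Qed.

Lemma cmeasurableM f g :
  cmeasurable f -> cmeasurable g -> cmeasurable (fun x => f x * g x).
Proof.
move=> [f1 f2] [g1 g2]; split.
  have := measurable_funB (measurable_funM f1 g1) (measurable_funM f2 g2).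
  by apply: eq_measurable_fun => x _ /=; case: (f x) (g x) => ? ? [].
have := measurable_funD (measurable_funM f1 g2) (measurable_funM f2 g1).
by apply: eq_measurable_fun => x _ /=; case: (f x) (g x) => ? ? [].
Qed.

Lemma cmeasurable_conj f : cmeasurable f -> cmeasurable (fun x => Num.conj (f x)).
Proof.
move=> [f1 f2]; split.
  by have := f1; apply: eq_measurable_fun => x _ /=; case: (f x).
have := measurable_funB (@measurable_cst _ _ _ _ setT (0 : R)) f2.
by apply: eq_measurable_fun => x _ /=; case: (f x) => a b; rewrite /= sub0r.
Qed.

Lemma cmeasurable_sum (I : Type) (s : seq I) (f : I -> T -> R[i]) :
  (forall i, cmeasurable (f i)) -> cmeasurable (fun x => \sum_(i <- s) f i x).
Proof.
move=> mf; elim: s => [|i s ih].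
  by under eq_fun do rewrite big_nil; exact: cmeasurable_cst.
by under eq_fun do rewrite big_cons; exact: cmeasurableD.
Qed.

Lemma measurable_cmx n (f : T -> 'M[R[i]]_n) :
  (forall i j, cmeasurable (fun x => f x i j)) -> measurable_fun [set: T] f.
Proof.
move=> mf; apply: (measurability (@open 'M[R[i]]_n)) => // _ [U oU <-].
rewrite setTI.
pose e k : R := k.+1%:R^-1.
pose box (q : 'M[rat * rat]_n) k := [set M : 'M[R[i]]_n | forall i j,
  `|complex.Re (M i j) - ratr (q i j).1| < e k /\ `|complex.Im (M i j) - ratr (q i j).2| < e k].
rewrite (_ : f @^-1` U = \bigcup_(qk : 'M[rat * rat]_n * nat)
   (if `[< box qk.1 qk.2 `<=` U >] then f @^-1` box qk.1 qk.2 else set0)).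
  apply: countable_bigcupT_measurable => [|[q k]] /=.
    exact: countableP.
  case: ifPn => // _.
  rewrite (_ : f @^-1` _ = \bigcap_(i : 'I_n) \bigcap_(j : 'I_n)
     ([set x | `|complex.Re (f x i j) - ratr (q i j).1| < e k] `&`
      [set x | `|complex.Im (f x i j) - ratr (q i j).2| < e k])); last first.
    apply/seteqP; split => [x bx i _ j _|x bx i j]; first exact: bx.
    exact: (bx i I j I).
  apply: fin_bigcap_measurable => // i _; apply: fin_bigcap_measurable => // j _.
  have [mRe mIm] := mf i j.
  have mlt (g : T -> R) (c : R) : measurable_fun setT g ->
      measurable [set x | `|g x - c| < e k].
    move=> mg; rewrite -[X in measurable X]setTI.
    rewrite (_ : [set x | _] = g @^-1` [set y | `|y - c| < e k]) //.
    apply: mg => //; rewrite (_ : [set y | _] = ball c (e k)).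
      exact: measurable_ball.
    by apply/seteqP; split => y; rewrite /ball /= distrC.
  by apply: measurableI; exact: mlt.
apply/seteqP; split => [x Ufx|x [[q k] _] /=]; last first.
  by case: ifPn => // /asboolP sub; exact: sub.
have /nbhs_ballP[r /= r0 rU] : nbhs (f x) U by exact: open_nbhs_nbhs.
have [r' r'0 rE] : exists2 r' : R, 0 < r' & r = r'%:C.
  move: r0; case: r {rU} => a b; rewrite ltcE /= => /andP[/eqP -> a0].
  by exists a.
have [k ek] : exists k, 4 * e k < r'.
  exists (Num.truncn (4 / r')) => /=.
  rewrite /e ltr_pdivrMr ?ltr0n// -ltr_pdivrMl//.
  by rewrite mulrC truncnS_gt.
have ek0 : 0 < e k by rewrite /e invr_gt0.
have rq (y : R) : exists q : rat, `|y - ratr q| < e k.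
  have /rat_in_itvoo[q] : y - e k < y + e k by rewrite ltrD2l gt0_cp.
  by rewrite in_itv/= => /andP[q1 q2]; exists q; rewrite ltr_distlC q1 q2.
have {}rq ij : exists p : rat * rat,
    `|complex.Re (f x ij.1 ij.2) - ratr p.1| < e k /\
    `|complex.Im (f x ij.1 ij.2) - ratr p.2| < e k.
  have [q1 ?] := rq (complex.Re (f x ij.1 ij.2)); have [q2 ?] := rq (complex.Im (f x ij.1 ij.2)).
  by exists (q1, q2).
have [q qP] := choice rq.
exists (\matrix_(i, j) q (i, j), k) => //=.
have fxb : box (\matrix_(i, j) q (i, j)) k (f x).
  by move=> i j; rewrite !mxE; exact: (qP (i, j)).
rewrite asboolT => // N bN; apply: rU; split => // i j.
rewrite /ball /= rE normc_def ltcR.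
have [a1 a2] := fxb i j; have [b1 b2] := bN i j.
move: a1 a2 b1 b2; case: (f x i j) => a a'; case: (N i j) => b b' /=.
set p := ratr _; set p' := ratr _ => a1 a2 b1 b2.
have h : `|a - b| < 2 * e k by apply/ltr_normlP; move/ltr_normlP: a1 b1 => [] ? ? /ltr_normlP[] ? ?; split; lra.
have h' : `|a' - b'| < 2 * e k by apply/ltr_normlP; move/ltr_normlP: a2 b2 => [] ? ? /ltr_normlP[] ? ?; split; lra.
apply: (@le_lt_trans _ _ (`|a - b| + `|a' - b'|)); last by lra.
rewrite -[leRHS]ger0_norm ?addr_ge0// -sqrtr_sqr ler_wsqrtr//.
rewrite -(real_normK (num_real (a - b))) -(real_normK (num_real (a' - b'))).
by rewrite sqrrD lerD2r lerDl mulrn_wge0// mulr_ge0.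
Qed.
End complex_measurability.

Lemma cmeasurable_coord {R : realType} n (i j : 'I_n) :
  cmeasurable (fun M : 'M[R[i]]_n => M i j).
Proof.
have mg (g : R[i] -> R) : (forall z w, `|g z - g w|%:C <= `|z - w|) ->
    measurable_fun [set: 'M[R[i]]_n] (fun M => g (M i j)).
  move=> lg; apply: (measurability _ (measurable_borelE (s := R))) => _ [U oU <-].
  rewrite setTI; apply: sub_sigma_algebra.
  have cg : continuous (fun M : 'M[R[i]]_n => g (M i j)).
    move=> M; apply/(cvgrPdist_lt (F := nbhs M)) => e e0.
    apply/nbhs_ballP; exists e%:C => /=; first by rewrite ltcR.
    move=> N [_ /(_ i j)]; rewrite /ball /= => MN.
    by rewrite -ltcR; exact: le_lt_trans (lg _ _) MN.
  by move/continuousP : cg; exact.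
split; apply: mg => z w.
  rewrite (le_trans _ (normc_ge_Re _))// lecR.
  by case: z w => ? ? [].
rewrite normc_def lecR -sqrtr_sqr ler_wsqrtr//.
by case: z w => a b [a' b'] /=; rewrite lerDr sqr_ge0.
Qed.

Section convolution.
Context {d : measure_display} {T : measurableType d} {R : realType}.
(* [add] and [zero] are the addition and the null element of [T]. *)
Variables (add : {mfun (T * T)%type >-> T}) (zero : T).

Definition convolution_of (mu nu : probability T R) : probability T R :=
  distribution (mu \x nu)%E add.

Definition convolution_pow_of (mu : probability T R) (n : nat) :
    probability T R :=
  iter n (convolution_of mu) (dirac zero).

End convolution.

Section additions.
Variables (R : realType) (n : nat).

Definition addR (p : R * R) : R := p.1 + p.2.

Let measurable_addR : measurable_fun [set: R * R] addR.
Proof. exact: measurable_funD. Qed.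

HB.instance Definition _ := isMeasurableFun.Build _ _ _ _ addR measurable_addR.

Definition addM (p : 'M[R[i]]_n * 'M[R[i]]_n) : 'M[R[i]]_n := p.1 + p.2.

Lemma cmeasurable_comp d (T : measurableType d) (f : T -> 'M[R[i]]_n) i j :
  measurable_fun [set: T] f -> cmeasurable (fun x => f x i j).
Proof.
move=> mf; have [cRe cIm] := @cmeasurable_coord R n i j.
by split; [move: (measurableT_comp cRe mf)|move: (measurableT_comp cIm mf)].
Qed.

Let measurable_addM : measurable_fun [set: 'M[R[i]]_n * 'M[R[i]]_n] addM.
Proof.
apply: measurable_cmx => i j; under eq_fun do rewrite mxE.
by apply: cmeasurableD; apply: cmeasurable_comp => //; exact: measurable_snd.
Qed.

HB.instance Definition _ := isMeasurableFun.Build _ _ _ _ addM measurable_addM.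

End additions.

Notation convR := (convolution_of (@addR _)).
Notation convR_pow := (convolution_pow_of (@addR _) 0).
Notation convM := (convolution_of (@addM _ _)).
Notation convM_pow := (convolution_pow_of (@addM _ _) 0).

Definition weakly_converges {d : measure_display} {T : borelType d}
    {R : realType} (mu_ : nat -> probability T R) (mu : probability T R) :=
  forall f : T -> R, continuous f -> (exists M : R, forall x, `|f x| <= M) ->
    (fun n => \int[mu_ n]_x (f x)%:E)%E @ \oo --> (\int[mu]_x (f x)%:E)%E.

Definition infinitely_divisible {R : realType} (mu : probability R R) :=
  forall n : nat, (1 <= n)%N ->
    exists mu_n : probability R R, measure_eq (convR_pow mu_n n) mu.

Section iid.
Variable R : realType.

Definition cons_tuple n (p : R * n.-tuple R) : n.+1.-tuple R :=
  [tuple of p.1 :: p.2].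

Let measurable_cons_tuple n : measurable_fun [set: R * n.-tuple R] (@cons_tuple n).
Proof. exact: measurable_cons. Qed.

HB.instance Definition _ n :=
  isMeasurableFun.Build _ _ _ _ (@cons_tuple n) (@measurable_cons_tuple n).

(* The law of [n] independent random variables with common law [mu]. *)
Fixpoint iid_law (mu : probability R R) (n : nat) : probability (n.-tuple R) R :=
  match n with
  | 0 => dirac [tuple]
  | n'.+1 => distribution (mu \x iid_law mu n')%E (@cons_tuple n')
  end.

End iid.

Section ensembles.
Variables (R : realType) (n : nat).
Notation M := 'M[R[i]]_n.

(* A probability measure on the complex matrices that is carried by the compact
   group of unitary matrices and invariant under its left translations. *)
Definition haar_unitary (H : probability M R) :=
  H [set U | U \is unitarymx] = 1%E /\
  forall W : M, W \is unitarymx -> forall A : set M, measurable A ->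
    H [set U | A (W *m U)] = H A.

Definition real_diag (x : n.-tuple R) : M := diag_mx (\row_j (tnth x j)%:C).

Definition conj_diag (p : M * n.-tuple R) : M :=
  p.1 *m real_diag p.2 *m p.1^t*.

Definition biunitary_diag (p : M * M * n.-tuple R) : M :=
  p.1.1 *m real_diag p.2 *m p.1.2.

Lemma measurable_real_diag d (T : measurableType d) (f : T -> n.-tuple R) :
  measurable_fun [set: T] f -> measurable_fun [set: T] (real_diag \o f).
Proof.
move=> mf; apply: measurable_cmx => i j.
rewrite /real_diag /=; under eq_fun do rewrite !mxE.
case: (i == j) => /=; last exact: cmeasurable_cst.
under eq_fun do rewrite mulr1n.
by apply: cmeasurable_real; move: (measurableT_comp (measurable_tnth i) mf).
Qed.

Lemma measurable_mulmx d (T : measurableType d) (f g : T -> M) :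
  measurable_fun [set: T] f -> measurable_fun [set: T] g ->
  measurable_fun [set: T] (fun x => f x *m g x).
Proof.
move=> mf mg; apply: measurable_cmx => i j; under eq_fun do rewrite mxE.
apply: cmeasurable_sum => k.
by apply: cmeasurableM; apply: cmeasurable_comp.
Qed.

Lemma measurable_adjoint d (T : measurableType d) (f : T -> M) :
  measurable_fun [set: T] f -> measurable_fun [set: T] (fun x => (f x)^t* : M).
Proof.
move=> mf; apply: measurable_cmx => i j; under eq_fun do rewrite !mxE.
by apply: cmeasurable_conj; apply: cmeasurable_comp.
Qed.

Let measurable_conj_diag : measurable_fun [set: M * n.-tuple R] conj_diag.
Proof.
apply: measurable_mulmx; last exact: measurable_adjoint.
by apply: measurable_mulmx => //; exact: measurable_real_diag.
Qed.

HB.instance Definition _ :=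
  isMeasurableFun.Build _ _ _ _ conj_diag measurable_conj_diag.

Let measurable_biunitary_diag :
  measurable_fun [set: M * M * n.-tuple R] biunitary_diag.
Proof.
apply: measurable_mulmx; last exact: measurableT_comp.
apply: measurable_mulmx; first exact: measurableT_comp.
exact: measurable_real_diag.
Qed.

HB.instance Definition _ :=
  isMeasurableFun.Build _ _ _ _ biunitary_diag measurable_biunitary_diag.

(* The laws of U diag(X_1, ..., X_n) U^* and of U diag(X_1, ..., X_n) V, for
   U, V with law [H], the X_j with law [mu], all of them independent. *)
Definition conj_diag_law (H : probability M R) (mu : probability R R) :
  probability M R := distribution (H \x iid_law mu n)%E conj_diag.

Definition biunitary_diag_law (H : probability M R) (mu : probability R R) :
  probability M R := distribution ((H \x H) \x iid_law mu n)%E biunitary_diag.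

(* [P] is the weak limit, as m tends to infinity, of the law of the sum of [k m]
   independent matrices with law [law (mu_ m)], for some approximating sequence
   [mu_ m]^{* k m} --> [mu]. The limit does not depend on that sequence, so
   asking for one sequence only does not enlarge the set of such [P]. *)
Definition is_matrix_limit (law : probability R R -> probability M R)
    (mu : probability R R) (P : probability M R) :=
  exists (mu_ : nat -> probability R R) (k : nat -> nat),
    [/\ k @ \oo --> \oo,
        weakly_converges (fun m => convR_pow (mu_ m) (k m)) mu &
        weakly_converges (fun m => convM_pow (law (mu_ m)) (k m)) P].

(* P_n^mu; it is carried by the closed subspace of Hermitian matrices, but is
   seen here as a measure on the space of all complex matrices. *)
Definition is_P_law (H : probability M R) := is_matrix_limit (conj_diag_law H).

(* L_n^mu *)
Definition is_L_law (H : probability M R) :=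
  is_matrix_limit (biunitary_diag_law H).

End ensembles.

(* Main.v *)
(** Fourier proof. If mu_m^{*k_m} tends to mu, then cf(mu_m)^{k_m} tends to cf(mu),
    with a common modulus of continuity, and cf(mu) has no zero because mu is
    infinitely divisible. A connectedness argument along segments, used in place of
    a continuous choice of logarithms, bounds k_m (cf(mu_m) - 1) on compact sets,
    so that this function approximates the Levy exponent of mu. The same argument
    shows that these approximate exponents are additive: for sequences attached to
    mu, nu and mu * nu, the combination k_m (cf(mu_m) - 1) + l_m (cf(nu_m) - 1)
    - r_m (cf(rho_m) - 1) tends to 0 uniformly on compact sets.

    The Fourier transform at A of the law of U diag(X) V is the mean over U and V of
    a product of values of cf(mu_m) at d points bounded in terms of A. It has
    therefore a first-order expansion in cf(mu_m) - 1, and its k_m-th powers have a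
    limit multiplicative in mu. Measures on matrices are determined by their
    Fourier transforms since the indicator of a half-space {L < a} is an iterated
    bounded pointwise limit of trigonometric polynomials in L. *)

Require Import Defs.
From HB Require Import structures.
From mathcomp Require Import all_boot all_order all_algebra.
From mathcomp Require Import complex.
From mathcomp Require Import all_classical all_reals all_analysis.
From mathcomp Require Import giry measurable_realfun ring lra.

Set Implicit Arguments.
Unset Strict Implicit.
Unset Printing Implicit Defensive.

Import Order.TTheory GRing.Theory Num.Theory.
Import numFieldTopology.Exports numFieldNormedType.Exports.
Import ComplexField.Normc.

Local Open Scope classical_set_scope.
Local Open Scope ring_scope.
Local Open Scope complex_scope.
Local Open Scope sesquilinear_scope.

(** The three limits in the statement come with unrelated exponents [k], [l], [r], and for a fixed
    index m nothing ties [mu_ m], [nu_ m] and [rho_ m] to each other: only the limits of the powers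
    are related. Each power therefore has to be replaced by an exponential whose argument can be
    added. The danger is the branch: a number whose k-th power is close to 1 may be close to any
    k-th root of unity. The value 1 at the origin, equicontinuity of the powers and a positive lower
    bound for the limit on compact sets exclude the wrong branches.

    The replacement is made twice: on the line, for all t in a compact set at once, then for the
    Fourier transform of one random matrix at a fixed A, which is a single number. Between the two,
    the product over the d points is linearized: its quadratic error is of order 1 / k^2, hence
    negligible after multiplication by k, and the linear term commutes with the mean over U and V.
    Sequences are compared throughout, without identifying the limit transforms. *)

(** * Modulus of complex numbers, powers and products near 1 *)

Section complex_modulus.
Context {R : realType}.
Implicit Types (z w u v : R[i]) (x y : R).

Lemma normc_ge0 z : 0 <= normc z.
Proof. by case: z => a b /=; exact: sqrtr_ge0. Qed.

Lemma normcX z n : normc (z ^+ n) = normc z ^+ n.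
Proof.
by elim: n => [|n ih]; rewrite ?expr0 ?normc1// !exprS normcM ih.
Qed.

Lemma normc_real x : normc x%:C = `|x|.
Proof. by rewrite /= expr0n /= addr0 sqrtr_sqr. Qed.

Lemma normc_nat n : normc (n%:R : R[i]) = n%:R.
Proof. by rewrite -(rmorph_nat (real_complex R)) normc_real normr_nat. Qed.

Lemma normc_triangle z w : normc (z + w) <= normc z + normc w.
Proof. exact: le_normcD. Qed.

Lemma normc_opp z : normc (- z) = normc z.
Proof. exact: normcN. Qed.

Lemma normc_distC z w : normc (z - w) = normc (w - z).
Proof. by rewrite -normc_opp opprB. Qed.

Lemma normc_sub z w : normc (z - w) <= normc z + normc w.
Proof. by rewrite -[normc w]normc_opp normc_triangle. Qed.

Lemma normc_dist_triangle u z w : normc (z - w) <= normc (z - u) + normc (u - w).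
Proof. by rewrite -[z - w](subrKA u) normc_triangle. Qed.

Lemma normc_dist_dist z w : `|normc z - normc w| <= normc (z - w).
Proof.
have := normc_triangle (z - w) w; have := normc_triangle (w - z) z.
rewrite !subrK [normc (w - z)]normc_distC => h1 h2.
by rewrite ler_norml; apply/andP; split; lra.
Qed.

Lemma normc_sum (I : Type) (s : seq I) (P : pred I) (f : I -> R[i]) :
  normc (\sum_(i <- s | P i) f i) <= \sum_(i <- s | P i) normc (f i).
Proof.
elim/big_rec2 : _ => [|i x z _ h]; first by rewrite normc0.
by rewrite (le_trans (normc_triangle _ _))// lerD2l.
Qed.

Lemma sqr_normcE z : normc z ^+ 2 = complex.Re z ^+ 2 + complex.Im z ^+ 2.
Proof. by case: z => a b /=; rewrite sqr_sqrtr// addr_ge0 ?sqr_ge0. Qed.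

Lemma ler_Re_normc z : `|complex.Re z| <= normc z.
Proof. by case: z => a b /=; rewrite -sqrtr_sqr ler_wsqrtr// lerDl sqr_ge0. Qed.

Lemma ler_Im_normc z : `|complex.Im z| <= normc z.
Proof. by case: z => a b /=; rewrite -sqrtr_sqr ler_wsqrtr// lerDr sqr_ge0. Qed.

Lemma normc_le_ReIm z : normc z <= `|complex.Re z| + `|complex.Im z|.
Proof.
case: z => a b /=; rewrite -[leRHS]ger0_norm ?addr_ge0// -sqrtr_sqr.
rewrite ler_wsqrtr// sqrrD -[in leLHS](real_normK (num_real a)).
rewrite -[in leLHS](real_normK (num_real b)) lerD2r lerDl mulrn_wge0//.
Qed.

Lemma normc_exprB u v k : normc u <= 1 -> normc v <= 1 ->
  normc (u ^+ k - v ^+ k) <= k%:R * normc (u - v).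
Proof.
move=> u1 v1; elim: k => [|k ih]; first by rewrite !expr0 subrr normc0 mul0r.
have -> : u ^+ k.+1 - v ^+ k.+1 = u * (u ^+ k - v ^+ k) + (u - v) * v ^+ k.
  by rewrite !exprS; ring.
rewrite (le_trans (normc_triangle _ _))// !normcM -[k.+1]addn1 natrD mulrDl mul1r.
rewrite lerD//.
  by rewrite (le_trans _ ih)// ler_piMl ?normc_ge0.
by rewrite ler_piMr ?normc_ge0// normcX exprn_ile1 ?normc_ge0.
Qed.

(** Passing from j to j + 1 multiplies the old error by at most 1 + |z| and adds j |z|^2. Since (j +
    1)^2 exceeds j^2 by 2 j + 1, the square bound absorbs both as long as j |z| <= 1/2. *)
Lemma normc_exprD1 z k : k%:R * normc z <= 1 / 2 ->
  normc ((1 + z) ^+ k - 1 - k%:R * z) <= (k%:R * normc z) ^+ 2.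
Proof.
have z0 := normc_ge0 z; move: {-2}(normc z) (erefl (normc z)) z0 => e ez z0 ke.
(* The smallness hypothesis concerns k itself and passes to smaller exponents only, hence an
   induction over j <= k. *)
suff : forall j, (j <= k)%N ->
  normc ((1 + z) ^+ j - 1 - j%:R * z) <= (j%:R * e) ^+ 2 by exact.
elim=> [_|j ih jk].
  by rewrite expr0 subrr mul0r subrr normc0 mul0r expr0n.
have -> : (1 + z) ^+ j.+1 - 1 - j.+1%:R * z =
    (1 + z) * ((1 + z) ^+ j - 1 - j%:R * z) + j%:R * (z * z).
  by rewrite exprS -[j.+1]addn1 natrD; ring.
have {}ih := ih (ltnW jk).
have je : j%:R * e <= 1 / 2.
  by rewrite (le_trans _ ke)// ler_wpM2r// ler_nat ltnW.
have h1 : normc (1 + z) <= 1 + e by rewrite (le_trans (normc_triangle _ _))// normc1 -ez.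
rewrite (le_trans (normc_triangle _ _))// !normcM normc_nat -ez.
have : normc (1 + z) * normc ((1 + z) ^+ j - 1 - j%:R * z) <= (1 + e) * (j%:R * e) ^+ 2.
  by rewrite ler_pM// normc_ge0.
rewrite -[j.+1]addn1 natrD; have := ler0n R j; move: (j%:R : R) je => q je q0.
set p := (X in X <= _) => hp.
have h2 : e * (q * e) ^+ 2 <= e ^+ 2 * (q + 1).
  have -> : e * (q * e) ^+ 2 = e ^+ 2 * q * (q * e) by ring.
  rewrite -mulrA ler_wpM2l ?sqr_ge0// (@le_trans _ _ (q * 1))//; last by lra.
  by rewrite ler_wpM2l// (le_trans je)//; lra.
have -> : ((q + 1) * e) ^+ 2 = (q * e) ^+ 2 + q * (e * e) + e ^+ 2 * (q + 1) by ring.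
apply: (le_trans (lerD hp (lexx _))); rewrite mulrDl mul1r; lra.
Qed.

(** With x = k |w - 1| <= 1/2, the expansion above gives |w^k - 1| >= x - x^2 >= x / 2. *)
Lemma normc_root_le w k : k%:R * normc (w - 1) <= 1 / 2 ->
  k%:R * normc (w - 1) <= 2 * normc (w ^+ k - 1).
Proof.
move=> h; have := normc_exprD1 h; rewrite [1 + _]addrC subrK => h1.
have := normc_triangle (w ^+ k - 1) (- (w ^+ k - 1 - k%:R * (w - 1))).
rewrite opprB addrCA subrr addr0 [normc (_ * _ - _)]normc_distC normcM normc_nat.
have : 0 <= k%:R * normc (w - 1) by rewrite mulr_ge0 ?normc_ge0.
by move: (k%:R * normc (w - 1)) h h1 => x h h1 x0; nra.
Qed.

(** All factors lie in the unit disc, so partial products stay there and the errors add up without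
    any exponential constant. *)
Lemma normc_prodB1 (I : Type) (s : seq I) (f : I -> R[i]) :
  (forall i, normc (f i) <= 1) ->
  [/\ normc (\prod_(i <- s) f i) <= 1,
      normc (\prod_(i <- s) f i - 1) <= \sum_(i <- s) normc (f i - 1) &
      normc (\prod_(i <- s) f i - 1 - \sum_(i <- s) (f i - 1)) <=
        (\sum_(i <- s) normc (f i - 1)) ^+ 2].
Proof.
move=> f1; elim: s => [|i s [ih1 ih0 ih2]].
  by rewrite !big_nil !subrr normc0 normc1 expr0n.
rewrite !big_cons; split.
- by rewrite normcM mulr_ile1 ?normc_ge0.
- set p := \prod_(_ <- _) _ in ih0 *.
  have -> : f i * p - 1 = (f i - 1) + f i * (p - 1) by ring.
  rewrite (le_trans (normc_triangle _ _))// lerD2l normcM (le_trans _ ih0)//.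
  by rewrite ler_piMl ?normc_ge0.
set p := \prod_(_ <- _) _ in ih1 ih2 *; set r := \sum_(_ <- _) normc _ in ih2 *.
set q := \sum_(_ <- _) _ in ih2 *.
have -> : f i * p - 1 - (f i - 1 + q) = f i * (p - 1 - q) + (f i - 1) * q by ring.
have qr : normc q <= r by exact: normc_sum.
have r0 : 0 <= r by rewrite sumr_ge0// => j _; exact: normc_ge0.
rewrite (le_trans (normc_triangle _ _))// !normcM.
have h1 : normc (f i) * normc (p - 1 - q) <= r ^+ 2.
  by rewrite (le_trans _ ih2)// ler_piMl ?normc_ge0.
have h2 : normc (f i - 1) * normc q <= normc (f i - 1) * r.
  by rewrite ler_wpM2l ?normc_ge0.
have := normc_ge0 (f i - 1); nra.
Qed.

End complex_modulus.

(** * Taylor bounds for the real exponential, sine and cosine *)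

Section real_exp_trig_bounds.
Context {R : realType}.
Implicit Types x y : R.

(** Both sides come from 1 + y <= exp y: y = x gives the lower bound, and y = - x gives exp x (1 -
    x) <= 1, hence the upper one. *)
Lemma expR_quadratic x : `|x| <= 1 / 2 -> `|expR x - 1 - x| <= 2 * x ^+ 2.
Proof.
rewrite ler_norml => /andP[x1 x2].
have h1 := expR_ge1Dx x; have h2 := expR_ge1Dx (- x).
rewrite ger0_norm; last by lra.
have e0 := expR_gt0 x.
have : expR x * (1 - x) <= 1.
  by rewrite -[leRHS](expRxMexpNx_1 x) ler_wpM2l// ltW.
by move=> ?; nra.
Qed.

Lemma normr_sin_le x : `|sin x| <= `|x|.
Proof.
wlog x0 : x / 0 <= x => [h|].
  have [|/ltW x0] := leP 0 x; first exact: h.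
  by rewrite -normrN -sinN -(normrN x) h// oppr_ge0.
have [c _] := MVT_segment x0 (fun y _ => is_derive_sin y)
  (continuous_subspaceT (@continuous_sin R)).
by rewrite sin0 !subr0 => ->; rewrite normrM ler_piMl// cos_max.
Qed.

Lemma onem_cos_le x : 0 <= 1 - cos x <= x ^+ 2 / 2.
Proof.
rewrite subr_ge0 cos_le1/=.
have -> : cos x = cos ((x / 2) *+ 2) by congr cos; rewrite mulr2n; lra.
rewrite cos_mulr2n cos2sin2.
have : sin (x / 2) ^+ 2 <= (x / 2) ^+ 2.
  by rewrite -real_normK ?num_real// -(real_normK (num_real (x / 2)))
    ler_sqr ?nnegrE// normr_sin_le.
by rewrite [(1 - _) *+ 2]mulr2n; lra.
Qed.

(** By the mean value theorem, sin x - x = (cos c - 1) x with c between 0 and x. *)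
Lemma sin_cubic x : `|sin x - x| <= `|x| ^+ 3 / 2.
Proof.
wlog x0 : x / 0 <= x => [h|].
  have [|/ltW x0] := leP 0 x; first exact: h.
  by rewrite -normrN opprD -sinN -(normrN x) h// oppr_ge0.
have [c] := MVT_segment x0 (fun y _ => is_derive_sin y)
  (continuous_subspaceT (@continuous_sin R)).
rewrite in_itv/= => /andP[c0 cx].
rewrite sin0 !subr0 => ->.
rewrite -{2}[x]mul1r -mulrBl normrM distrC (ger0_norm x0).
have /andP[h1 h2] := onem_cos_le c.
rewrite ger0_norm//; have : c ^+ 2 <= x ^+ 2 by rewrite ler_sqr.
move=> h; have : (1 - cos c) * x <= (x ^+ 2 / 2) * x by rewrite ler_wpM2r//; lra.
by rewrite !exprS expr0; lra.
Qed.

End real_exp_trig_bounds.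

(** * The complex exponential *)

Section complex_exponential.
Context {R : realType}.
Implicit Types z w : R[i].

Definition cexp z : R[i] :=
  (expR (complex.Re z) * cos (complex.Im z)) +i* (expR (complex.Re z) * sin (complex.Im z)).

Lemma cexp0 : cexp 0 = 1.
Proof. by rewrite /cexp /= expR0 cos0 sin0 mulr1 mulr0. Qed.

Lemma cexpD z w : cexp (z + w) = cexp z * cexp w.
Proof.
case: z w => a b [c d]; rewrite /cexp /= expRD cosD sinD.
by apply/eqP; rewrite eq_complex /=; apply/andP; split; apply/eqP; ring.
Qed.

Lemma normc_cexp z : normc (cexp z) = expR (complex.Re z).
Proof.
rewrite /cexp /= !exprMn -mulrDr cos2Dsin2 mulr1 sqrtr_sqr.
by rewrite ger0_norm// expR_ge0.
Qed.

Lemma cexpMn z n : cexp (n%:R * z) = cexp z ^+ n.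
Proof.
elim: n => [|n ih]; first by rewrite mul0r cexp0 expr0.
by rewrite -[n.+1]addn1 natrD mulrDl mul1r cexpD ih exprD expr1.
Qed.

(** For z = a + i b, the real part of the remainder is at most 2 a^2 + b^2 and the imaginary part at
    most 2 a^2 + 3 b^2; the constant 4 is their sum. *)
Lemma cexp_quadratic z : normc z <= 1 / 2 ->
  normc (cexp z - 1 - z) <= 4 * normc z ^+ 2.
Proof.
move=> z1; have := ler_Re_normc z; have := ler_Im_normc z.
rewrite sqr_normcE; case: z z1 => a b z1; rewrite [complex.Re _]/= [complex.Im _]/=.
move=> /le_trans/(_ z1) bh /le_trans/(_ z1) ah {z1}.
rewrite (le_trans (normc_le_ReIm _))//= /cexp /= subr0.
have ea := expR_quadratic ah.
have /andP[c1 c2] := onem_cos_le b; have s1 := normr_sin_le b; have s2 := sin_cubic b.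
have b2 : `|b| ^+ 2 = b ^+ 2 by rewrite real_normK ?num_real.
have a2 : `|a| ^+ 2 = a ^+ 2 by rewrite real_normK ?num_real.
have a0 := normr_ge0 a; have b0 := normr_ge0 b.
have h1 : `|expR a * cos b - 1 - a| <= 2 * a ^+ 2 + b ^+ 2.
  have -> : expR a * cos b - 1 - a = (expR a - 1 - a) * cos b - (1 + a) * (1 - cos b) by ring.
  rewrite (le_trans (ler_normB _ _))// !normrM (ger0_norm c1) lerD//.
    by rewrite (le_trans _ ea)// ler_piMr// cos_max.
  have : `|1 + a| <= 2 by rewrite (le_trans (ler_normD _ _))// normr1; lra.
  have := normr_ge0 (1 + a); nra.
have h2 : `|expR a * sin b - b| <= 2 * a ^+ 2 + 3 * b ^+ 2.
  have -> : expR a * sin b - b = (expR a - 1 - a) * sin b + a * sin b + (sin b - b) by ring.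
  rewrite (le_trans (ler_normD _ _))// (le_trans (lerD (ler_normD _ _) (lexx _)))//.
  rewrite !normrM.
  have e1 : `|expR a - 1 - a| * `|sin b| <= a ^+ 2.
    have := normr_ge0 (expR a - 1 - a); have := normr_ge0 (sin b).
    move: ea s1 bh a2 (sqr_ge0 a); set p := `|expR a - 1 - a|; set q := `|sin b|.
    move=> ea s1 bh a2 a2' q0 p0.
    have : p * q <= (2 * a ^+ 2) * (1 / 2) by rewrite ler_pM//; lra.
    by lra.
  have e2 : `|a| * `|sin b| <= a ^+ 2 + b ^+ 2.
    have : `|a| * `|sin b| <= `|a| * `|b| by rewrite ler_wpM2l.
    rewrite -a2 -b2; nra.
  have e3 : `|b| ^+ 3 <= b ^+ 2.
    rewrite exprSr b2 ler_piMr ?sqr_ge0//; lra.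
  have := sqr_ge0 b; lra.
have := sqr_ge0 b; have := sqr_ge0 a; lra.
Qed.

(* As |u| <= 1 forces Re (u - 1) <= 0, both factors compared here are
   contractions, so the error only accumulates linearly in k. *)
Lemma normc_expr_cexp u k : normc u <= 1 -> normc (u - 1) <= 1 / 2 ->
  normc (u ^+ k - cexp (k%:R * (u - 1))) <= 4 * k%:R * normc (u - 1) ^+ 2.
Proof.
move=> u1 u2; rewrite cexpMn.
have re : complex.Re (u - 1) <= 0.
  have := ler_Re_normc u; case: u u1 u2 => a b u1 u2 /= h.
  by rewrite subr_le0 (le_trans (ler_norm _))// (le_trans h).
rewrite (le_trans (normc_exprB _ _ _))//.
  by rewrite normc_cexp -expR0 ler_expR.
rewrite [4 * _]mulrC -mulrA ler_wpM2l//.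
rewrite normc_distC; have := cexp_quadratic u2.
by have -> : cexp (u - 1) - 1 - (u - 1) = cexp (u - 1) - u by ring.
Qed.

(** For |z| <= 1/8 the remainder 4 |z|^2 is at most |z| / 2. This local inverse bound plays the part
    of a logarithm near 1. *)
Lemma normc_le_cexpB1 z : normc z <= 1 / 8 -> normc z <= 2 * normc (cexp z - 1).
Proof.
move=> z1; have h := @cexp_quadratic z; have z0 := normc_ge0 z.
have {}h : normc (cexp z - 1 - z) <= 4 * normc z ^+ 2 by apply: h; lra.
have := normc_triangle (cexp z - 1) (- (cexp z - 1 - z)).
rewrite opprB addrCA subrr addr0 [normc (z - (_ - _))]normc_distC; nra.
Qed.

End complex_exponential.

(** * Limits of complex sequences *)

Section complex_limits.
Context {R : realType}.
Implicit Types (u v : nat -> R[i]) (p q : R[i]).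

(** Convergence is spelled out with the real-valued modulus, so that all estimates take place in
    [R]. *)
Definition cvgc u p :=
  forall e : R, 0 < e -> \forall m \near \oo, normc (u m - p) <= e.

Lemma normc_small_eq0 p : (forall e : R, 0 < e -> normc p <= e) -> p = 0.
Proof.
move=> h; apply: eq0_normc; apply/eqP; rewrite eq_le normc_ge0 andbT.
by apply/ler_addgt0Pl => e e0; rewrite addr0 h.
Qed.

Lemma cvgc_unique u p q : cvgc u p -> cvgc u q -> p = q.
Proof.
move=> up uq; apply/eqP; rewrite -subr_eq0; apply/eqP/normc_small_eq0 => e e0.
have e2 : 0 < e / 2 by rewrite divr_gt0.
near \oo => m.
rewrite (le_trans (normc_dist_triangle (u m) _ _))// [leRHS]splitr.
rewrite lerD//; first by rewrite normc_distC; near: m; exact: up.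
by near: m; exact: uq.
Unshelve. all: by end_near. Qed.

Lemma cvgc_prod u v p q : (forall m, normc (u m) <= 1) -> cvgc u p -> cvgc v q ->
  cvgc (fun m => u m * v m) (p * q).
Proof.
move=> u1 up vq e e0; have e2 : 0 < e / 2 by rewrite divr_gt0.
have q1 : 0 < normc q + 1 by rewrite ltr_wpDl ?normc_ge0.
have e3 : 0 < e / 2 / (normc q + 1) by rewrite divr_gt0.
near=> m.
have -> : u m * v m - p * q = u m * (v m - q) + (u m - p) * q by ring.
rewrite (le_trans (normc_triangle _ _))// !normcM [leRHS]splitr lerD//.
  rewrite (@le_trans _ _ (normc (v m - q)))//; first by rewrite ler_piMl ?normc_ge0.
  by near: m; exact: vq.
rewrite (@le_trans _ _ (normc (u m - p) * (normc q + 1)))//.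
  by rewrite ler_wpM2l ?normc_ge0// lerDl.
by rewrite -ler_pdivlMr//; near: m; exact: up.
Unshelve. all: by end_near. Qed.

Lemma cvgc_shift0 u v p : cvgc u p -> cvgc (fun m => u m - v m) 0 -> cvgc v p.
Proof.
move=> up uv e e0; have e2 : 0 < e / 2 by rewrite divr_gt0.
near=> m.
rewrite (le_trans (normc_dist_triangle (u m) _ _))// [leRHS]splitr lerD//.
  by rewrite normc_distC -[_ - _]subr0; near: m; exact: uv.
by near: m; exact: up.
Unshelve. all: by end_near. Qed.

Lemma near_nat_ge (k : nat -> nat) (x : R) : k @ \oo --> \oo ->
  \forall m \near \oo, x <= (k m)%:R.
Proof.
move=> koo; near=> m; apply: ltW; near: m; exact: (koo _ (nbhs_infty_gtr x)).
Unshelve. all: by end_near. Qed.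

Lemma near_forall_lt (P : nat -> nat -> Prop) N :
  (forall j, \forall m \near \oo, P j m) ->
  \forall m \near \oo, forall j, (j < N)%N -> P j m.
Proof.
move=> h; elim: N => [|N ih]; first by near=> m.
near=> m => j; rewrite ltnS leq_eqVlt => /predU1P[->|].
  by near: m; exact: h.
by move: j; near: m; exact: ih.
Unshelve. all: by end_near. Qed.

End complex_limits.

(** * Uniform continuity and the connectedness argument *)

Section uniform_continuity.
Context {R : realType}.

Definition ucont (f : R -> R[i]) := forall e : R, 0 < e ->
  exists2 h : R, 0 < h & forall s t, `|s - t| <= h -> normc (f s - f t) <= e.

Lemma ucont_normc_continuous (f : R -> R[i]) : ucont f -> continuous (fun x => normc (f x)).
Proof.
move=> uf x; apply/cvgrPdist_le => e e0; have [h h0 fh] := uf _ e0.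
have : nbhs x (ball x h) by exact: nbhsx_ballx.
apply: filterS => y; rewrite /ball /= => /ltW xy.
by rewrite (le_trans (normc_dist_dist _ _))// fh.
Qed.

(** This shape covers both paths to which [normc_ivt_gap] is applied: the rescaled ratio in
    [root_step], and each of the three terms of the combined exponent in [power_approx_log]. *)
Lemma ucont_affine (f : R -> R[i]) (c t s : R) (z : R[i]) : ucont f ->
  ucont (fun x => z * (f (t + x * s) - f c)).
Proof.
move=> uf e e0.
have z1 : 0 < normc z + 1 by rewrite ltr_wpDl ?normc_ge0.
have s1 : 0 < `|s| + 1 by rewrite ltr_wpDl.
have [h h0 fh] := uf (e / (normc z + 1)) (divr_gt0 e0 z1).
exists (h / (`|s| + 1)); first by rewrite divr_gt0.
move=> x y xy; rewrite -mulrBr opprD addrACA opprK addNr addr0 normcM.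
rewrite (@le_trans _ _ ((normc z + 1) * normc (f (t + x * s) - f (t + y * s))))//.
  by rewrite ler_wpM2r ?normc_ge0// lerDl.
rewrite mulrC -ler_pdivlMr// fh// opprD addrACA subrr add0r -mulrBl normrM.
rewrite (@le_trans _ _ (`|x - y| * (`|s| + 1)))//; first by rewrite ler_wpM2l// lerDl.
by rewrite -ler_pdivlMr.
Qed.

Lemma ucontD (f g : R -> R[i]) : ucont f -> ucont g -> ucont (fun x => f x + g x).
Proof.
move=> uf ug e e0; have e2 : 0 < e / 2 by rewrite divr_gt0.
have [h h0 fh] := uf _ e2; have [h' h'0 gh] := ug _ e2.
exists (Num.min h h'); first by rewrite lt_min h0.
move=> s t; rewrite le_min => /andP[/fh sth /gh sth'].
by rewrite opprD addrACA (le_trans (normc_triangle _ _))// [leRHS]splitr lerD.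
Qed.

(** The modulus starts at 0 and takes no value in ]c / 2, c]. If it ended above c / 2 it would end
    above c, and the intermediate value theorem would produce a point where it equals c. *)
Lemma normc_ivt_gap (f : R -> R[i]) (c : R) : ucont f -> f 0 = 0 -> 0 < c ->
  (forall x, 0 <= x <= 1 -> normc (f x) <= c -> normc (f x) <= c / 2) ->
  normc (f 1) <= c / 2.
Proof.
move=> uf f0 c0 gap; rewrite leNgt; apply/negP => f1.
have c2 : c / 2 < c by rewrite ltr_pdivrMr// ltr_pMr// ltr1n.
have fc : c < normc (f 1).
  rewrite ltNge; apply/negP => /gap; rewrite ler01 lexx => /(_ isT).
  by rewrite leNgt f1.
have [|x x01 /= fx] := @IVT R (fun x => normc (f x)) 0 1 c ler01
    (continuous_subspaceT (ucont_normc_continuous uf)).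
  by rewrite /= f0 normc0 ge_min le_max (ltW c0)/= (ltW fc) orbT.
move: x01; rewrite in_itv/= => /gap; rewrite fx lexx => /(_ isT).
by rewrite leNgt c2.
Qed.

Lemma ucont_lower_bound (f : R -> R[i]) (C : R) : ucont f -> (forall t, f t != 0) ->
  exists2 d : R, 0 < d & forall t, `|t| <= C -> d <= normc (f t).
Proof.
move=> uf fn0; have [C0|C0] := leP 0 C; last first.
  (* For C < 0 the claim is vacuous, and 1 is an arbitrary positive value. *)
  by exists 1 => // t /le_lt_trans/(_ C0); rewrite ltNge normr_ge0.
have CC : - C <= C by lra.
have [c _ fc] := EVT_min CC (continuous_subspaceT (ucont_normc_continuous uf)).
exists (normc (f c)).
  rewrite lt0r normc_ge0 andbT; apply: contra (fn0 c) => /eqP/eq0_normc ->.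
  by [].
by move=> t; rewrite ler_norml => tC; apply: fc; rewrite in_itv/=.
Qed.

End uniform_continuity.

(** * Powers of characteristic functions converging to a limit without zeros *)

Section power_approximation.
Context {R : realType}.

Definition chf_like (f : R -> R[i]) :=
  [/\ f 0 = 1, forall t, normc (f t) <= 1 & ucont f].

(** The Fourier side of the weak convergence of convolution powers. Equicontinuity is asked of the
    powers, since these are what weak convergence controls; the bases [a m] are dealt with later, by
    extracting roots. *)
Record power_approx (a : nat -> R -> R[i]) (k : nat -> nat) (F : R -> R[i]) : Prop := {
  power_exponents : k @ \oo --> \oo;
  power_base : forall m, chf_like (a m);
  power_limit : chf_like F;
  power_equicont : forall e : R, 0 < e -> exists2 h : R, 0 < h &
    \forall m \near \oo, forall s t, `|s - t| <= h ->
      normc (a m s ^+ k m - a m t ^+ k m) <= e;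
  power_cvg : forall t, cvgc (fun m => a m t ^+ k m) (F t) }.

(* Since f (t + x * (s - t)) / f t is 1 at x = 0 and moves continuously, it stays
   in the component of 1 of the set of w with w ^+ k close to 1, where the k-th
   power map expands distances by a factor comparable to k. *)
Lemma root_step (f : R -> R[i]) k (s t d : R) : chf_like f -> 0 < d ->
  d <= normc (f t ^+ k) ->
  (forall x, 0 <= x <= 1 -> normc (f (t + x * (s - t)) ^+ k - f t ^+ k) <= d / 8) ->
  k%:R * normc (f s - f t) <= 1 / 4.
Proof.
move=> [f0 f1 uf] d0 dft fk; case: k dft fk => [|k] dft fk.
  by rewrite mul0r; lra.
have ft0 : f t != 0.
  by apply: contraTneq dft => ->; rewrite expr0n normc0 -ltNge.
have nft0 : 0 < normc (f t).
  rewrite lt0r normc_ge0 andbT; apply: contra ft0 => /eqP/eq0_normc ->.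
  by [].
(* [w] is k times the deviation from 1 of the ratio of values of [f], written as an affine function
   of [f] so that its uniform continuity is immediate. *)
pose w x := k.+1%:R / f t * (f (t + x * (s - t)) - f t).
have wE x : normc (w x) = k.+1%:R * normc (f (t + x * (s - t)) / f t - 1).
  rewrite -normc_nat -normcM /w; congr normc.
  by field.
have wk x : normc ((f (t + x * (s - t)) / f t) ^+ k.+1 - 1) =
    normc (f (t + x * (s - t)) ^+ k.+1 - f t ^+ k.+1) / normc (f t ^+ k.+1).
  rewrite -normcV -normcM exprMn exprVn mulrBl divff ?expf_neq0//.
(* The gap argument is run with c = 1/2, the range of [normc_root_le]: the relative error of the
   powers is at most (d / 8) / d = 1/8, and the factor 2 of that lemma turns it into 1/4 = c / 2. *)
have : normc (w 1) <= 1 / 2 / 2.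
  apply: normc_ivt_gap => //.
  - exact: ucont_affine.
  - by rewrite /w mul0r addr0 subrr mulr0.
  - move=> x x01; rewrite wE => /normc_root_le/le_trans; apply.
    rewrite wk; have := fk x x01; set A := normc _; set D := normc (f t ^+ _) => AD.
    have D0 : 0 < D by exact: lt_le_trans dft.
    have : A / D <= 1 / 8; last by lra.
    by rewrite ler_pdivrMr//; rewrite -/D in dft; lra.
rewrite wE mul1r [t + _]addrC subrK => /(fun h => le_trans _ h) h.
apply: le_trans (h _ _) _; last by lra.
have -> : f s - f t = (f s / f t - 1) * f t by rewrite mulrBl divfK// mul1r.
by rewrite normcM ler_wpM2l// ler_piMr ?normc_ge0.
Qed.

Section power_approx_lemmas.
Context (a : nat -> R -> R[i]) (k : nat -> nat) (F : R -> R[i]).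
Hypotheses (aF : power_approx a k F) (F_neq0 : forall t, F t != 0).

(** Pointwise convergence on a finite grid, together with equicontinuity of the powers and uniform
    continuity of the limit, gives uniform convergence on a compact set; each of the three
    contributes e / 3. *)
Lemma power_ucvg (C e : R) : 0 < e -> \forall m \near \oo, forall t, `|t| <= C ->
  normc (a m t ^+ k m - F t) <= e.
Proof.
move=> e0; have e3 : 0 < e / 3 by rewrite divr_gt0.
have [h1 h10 ah] := power_equicont aF e3.
have [_ _ uF] := power_limit aF.
have [h2 h20 Fh] := uF _ e3.
pose h := Num.min h1 h2; have h0 : 0 < h by rewrite lt_min h10.
(* Every t in [-C, C] is at distance at most h from one of the points j h - C with j < N. *)
pose N := (Num.truncn (2 * C / h)).+1.
have grid := near_forall_lt N (fun j => power_cvg aF (j%:R * h - C) e3).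
near=> m.
have ah_m : forall s t, `|s - t| <= h1 -> normc (a m s ^+ k m - a m t ^+ k m) <= e / 3.
  by near: m; exact: ah.
have grid_m : forall j, (j < N)%N ->
    normc (a m (j%:R * h - C) ^+ k m - F (j%:R * h - C)) <= e / 3.
  by near: m; exact: grid.
move=> t; rewrite ler_norml => /andP[t1 t2].
pose j := Num.truncn ((t + C) / h).
have tC : 0 <= (t + C) / h by rewrite divr_ge0//; lra.
have jN : (j < N)%N by rewrite ltnS le_truncn// ler_pM2r ?invr_gt0//; lra.
have tj : `|t - (j%:R * h - C)| <= h.
  have /andP[] := truncn_itv tC.
  rewrite -/j ler_pdivlMr// ltr_pdivrMr// -[j.+1]addn1 natrD mulrDl mul1r => j1 j2.
  by rewrite ger0_norm; lra.
rewrite (le_trans (normc_dist_triangle (a m (j%:R * h - C) ^+ k m) _ _))//.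
rewrite (_ : e = e / 3 + (e / 3 + e / 3)); last by lra.
rewrite lerD//.
  by apply: ah_m; rewrite (le_trans tj)// ge_min lexx.
rewrite (le_trans (normc_dist_triangle (F (j%:R * h - C)) _ _))// lerD//.
  exact: grid_m.
by rewrite Fh// distrC (le_trans tj)// ge_min lexx orbT.
Unshelve. all: by end_near. Qed.

(** The segment from 0 to t is cut into N pieces of length at most h. By [root_step], each piece
    changes [a m] by at most 1 / (4 k), which gives the bound N / 4. The lower bound on |a^k| fed to
    [root_step] is d / 2: half of the minimum d of |F|, the other half being spent on uniform
    convergence. *)
Lemma power_bounded (C : R) : exists2 B : R, 0 <= B & \forall m \near \oo,
  forall t, `|t| <= C -> (k m)%:R * normc (a m t - 1) <= B.
Proof.
have [_ _ uF] := power_limit aF.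
have [d d0 dF] := ucont_lower_bound C uF F_neq0.
have d2 : 0 < d / 2 by rewrite divr_gt0.
have d16 : 0 < d / 2 / 8 by rewrite !divr_gt0.
have [h h0 ah] := power_equicont aF d16.
have lim := power_ucvg C d2.
pose N := (Num.truncn (C / h)).+1.
have N0 : 0 < (N%:R : R) by rewrite ltr0n.
exists (N%:R / 4); first by rewrite divr_ge0.
near=> m.
have ah_m : forall s t, `|s - t| <= h ->
    normc (a m s ^+ k m - a m t ^+ k m) <= d / 2 / 8 by near: m; exact: ah.
have lim_m : forall t, `|t| <= C -> normc (a m t ^+ k m - F t) <= d / 2.
  by near: m; exact: lim.
move=> t tC.
have [am0 _ _] := power_base aF m.
have scale (x : R) : 0 <= x <= 1 -> `|x * t| <= `|t|.
  by move=> /andP[x0 x1]; rewrite normrM ger0_norm// ler_piMl.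
suff : forall j, (j <= N)%N -> (k m)%:R * normc (a m (j%:R / N%:R * t) - 1) <= j%:R / 4.
  by move/(_ _ (leqnn N)); rewrite divff ?mul1r// gt_eqF.
elim=> [_|j ih jN]; first by rewrite !mul0r am0 subrr normc0 mulr0.
rewrite (le_trans (ler_wpM2l _ (normc_dist_triangle (a m (j%:R / N%:R * t)) _ _)))//.
have -> : j.+1%:R / 4 = 1 / 4 + j%:R / 4 :> R by rewrite -[j.+1]addn1 natrD; lra.
rewrite mulrDr lerD// ?ih// 1?ltnW//.
have sC : `|j%:R / N%:R * t| <= C.
  rewrite (le_trans _ tC)// scale// divr_ge0//= ler_pdivrMr// mul1r ler_nat.
  exact: ltnW.
apply: (@root_step _ _ _ _ (d / 2)) => //.
- exact: (power_base aF).
- have : normc (a m (j%:R / N%:R * t) ^+ k m - F (j%:R / N%:R * t)) <= d / 2.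
    exact: lim_m.
  have := dF _ sC; have := normc_dist_dist (a m (j%:R / N%:R * t) ^+ k m) (F (j%:R / N%:R * t)).
  by rewrite ler_norml => /andP[] *; lra.
- move=> x x01; apply: ah_m.
  rewrite addrAC subrr add0r -mulrBl -mulrBl -[j.+1]addn1 natrD addrAC subrr add0r mul1r.
  rewrite mulrA normrM (@le_trans _ _ (N%:R^-1 * `|t|))//.
    rewrite ler_wpM2r// normrM [`|N%:R^-1|]ger0_norm// ler_piMl//.
    by move: x01 => /andP[x0 x1]; rewrite ger0_norm.
  rewrite mulrC ler_pdivrMr// (le_trans tC)// mulrC -ler_pdivrMr//.
  by rewrite ltW// /N truncnS_gt.
Unshelve. all: by end_near. Qed.

Lemma power_cexp (C e : R) : 0 < e -> \forall m \near \oo, forall t, `|t| <= C ->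
  normc (cexp ((k m)%:R * (a m t - 1)) - F t) <= e.
Proof.
move=> e0; have e2 : 0 < e / 2 by rewrite divr_gt0.
have [B B0 kB] := power_bounded C.
have lim := power_ucvg C e2.
(* The first condition makes |a - 1| <= B / k at most 1/2, with + 1 ensuring k > 0 even if B = 0.
   The second makes the error 4 k |a - 1|^2 <= 4 B^2 / k of [normc_expr_cexp] at most e / 2. *)
have k1 := near_nat_ge (2 * B + 1) (power_exponents aF).
have k2 := near_nat_ge (8 * B ^+ 2 / e) (power_exponents aF).
near=> m => t tC.
have [_ a1 _] := power_base aF m.
have k1_m : 2 * B + 1 <= (k m)%:R by near: m; exact: k1.
have k2_m : 8 * B ^+ 2 / e <= (k m)%:R by near: m; exact: k2.
have kB_m : (k m)%:R * normc (a m t - 1) <= B by move: t tC; near: m; exact: kB.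
have lim_m : normc (a m t ^+ k m - F t) <= e / 2 by move: t tC {kB_m}; near: m; exact: lim.
rewrite (le_trans (normc_dist_triangle (a m t ^+ k m) _ _))// [leRHS]splitr lerD//.
rewrite normc_distC; move: kB_m k1_m k2_m; have := normc_ge0 (a m t - 1) => x0 KB k1'.
have K0 : 0 < ((k m)%:R : R) by lra.
have small : normc (a m t - 1) <= 1 / 2.
  have : (k m)%:R * normc (a m t - 1) <= (k m)%:R * (1 / 2) by lra.
  by rewrite ler_pM2l.
rewrite ler_pdivrMr// => k2'; rewrite (le_trans (normc_expr_cexp _ _ _))//.
move: (normc _) small K0 x0 KB k1' k2' => x; move: ((k m)%:R : R) => K x2 K0 x0 KB k1' k2'.
have : (K * x) ^+ 2 <= B ^+ 2 by rewrite ler_sqr ?nnegrE ?mulr_ge0// ltW.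
move=> h; rewrite -(ler_pM2r K0).
have -> : 4 * K * x ^+ 2 * K = 4 * (K * x) ^+ 2 by ring.
lra.
Unshelve. all: by end_near. Qed.

End power_approx_lemmas.

Lemma normc_cexp_le1 (u : R[i]) n : normc u <= 1 -> normc (cexp (n%:R * (u - 1))) <= 1.
Proof.
move=> u1; rewrite cexpMn normcX exprn_ile1 ?normc_ge0// normc_cexp -expR0 ler_expR.
have := ler_Re_normc u; case: u u1 => x y u1 /= h.
by rewrite subr_le0 (le_trans (ler_norm _))// (le_trans h).
Qed.

(** The exponential of the combination g is close to F G / (F G) = 1 on [-C, C]. This alone only
    places g near a multiple of 2 i pi; as g vanishes at 0, the gap argument along x -> g (x t)
    forces that multiple to be 0. *)
Theorem power_approx_log (a b c : nat -> R -> R[i]) (k l r : nat -> nat)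
    (F G : R -> R[i]) :
  power_approx a k F -> power_approx b l G -> power_approx c r (fun t => F t * G t) ->
  (forall t, F t != 0) -> (forall t, G t != 0) ->
  forall C e : R, 0 < e -> \forall m \near \oo, forall t, `|t| <= C ->
  normc ((k m)%:R * (a m t - 1) + (l m)%:R * (b m t - 1)
         - (r m)%:R * (c m t - 1)) <= e.
Proof.
move=> aF bG cFG F0 G0 C e e0.
have FG0 t : F t * G t != 0 by rewrite mulf_neq0.
have [_ F1 uF] := power_limit aF; have [_ G1 uG] := power_limit bG.
have [_ _ uFG] := power_limit cFG.
have [d d0 dFG] := ucont_lower_bound C uFG FG0.
(* [eta] bounds |exp g - 1|. Where |g| <= 1/8 this gives |g| <= 2 eta: with eta <= 1/32 the gap from
   1/16 to 1/8 opens, and with eta <= e / 2 the final bound is e. *)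
pose eta := Num.min (1 / 32) (e / 2).
have eta0 : 0 < eta by rewrite lt_min !divr_gt0.
have eta1 : eta <= 1 / 32 by rewrite ge_min lexx.
have eta2 : eta <= e / 2 by rewrite ge_min lexx orbT.
(* With th <= d / 2 the third exponential keeps modulus at least d / 2; the three errors th then add
   up to 3 th <= eta d / 2, to be divided by that modulus. *)
pose th := Num.min (d / 2) (eta * d / 6).
have th0 : 0 < th by rewrite lt_min !divr_gt0// mulr_gt0.
have th1 : th <= d / 2 by rewrite ge_min lexx.
have th2 : th <= eta * d / 6 by rewrite ge_min lexx orbT.
have LF := power_cexp aF F0 C th0.
have LG := power_cexp bG G0 C th0.
have LH := power_cexp cFG FG0 C th0.
near=> m.
pose g t := (k m)%:R * (a m t - 1) + (l m)%:R * (b m t - 1) - (r m)%:R * (c m t - 1).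
have small t : `|t| <= C -> normc (cexp (g t) - 1) <= eta.
  move=> tC.
  have LF_m : normc (cexp ((k m)%:R * (a m t - 1)) - F t) <= th.
    by move: t tC; near: m; exact: LF.
  have LG_m : normc (cexp ((l m)%:R * (b m t - 1)) - G t) <= th.
    by move: t tC {LF_m}; near: m; exact: LG.
  have LH_m : normc (cexp ((r m)%:R * (c m t - 1)) - F t * G t) <= th.
    by move: t tC {LF_m LG_m}; near: m; exact: LH.
  have X1 : normc (cexp ((k m)%:R * (a m t - 1))) <= 1.
    by apply: normc_cexp_le1; have [] := power_base aF m.
  have {}dFG := dFG _ tC; have {}G1 := G1 t.
  have : cexp (g t) * cexp ((r m)%:R * (c m t - 1)) =
      cexp ((k m)%:R * (a m t - 1)) * cexp ((l m)%:R * (b m t - 1)).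
    by rewrite -!cexpD; congr cexp; rewrite /g subrK.
  move: (cexp _) (cexp _) (cexp _) (cexp _) LF_m LG_m LH_m X1 => V Z Y X LF_m LG_m LH_m X1 VZ.
  have ZV : (V - 1) * Z = X * (Y - G t) + (X - F t) * G t - (Z - F t * G t).
    by rewrite mulrBl VZ; ring.
  have dZ : d / 2 <= normc Z.
    have := normc_dist_dist Z (F t * G t); rewrite ler_norml => /andP[] *; lra.
  have h1 : normc (V - 1) * normc Z <= 3 * th.
    rewrite -normcM ZV (le_trans (normc_sub _ _))//.
    rewrite (_ : 3 * th = th + th + th); last by lra.
    rewrite lerD// (le_trans (normc_triangle _ _))// !normcM lerD//.
      by rewrite (le_trans _ LG_m)// ler_piMl ?normc_ge0.
    by rewrite (le_trans _ LF_m)// ler_piMr ?normc_ge0.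
  have d2 : 0 < d / 2 by rewrite divr_gt0.
  rewrite -(ler_pM2r d2) (@le_trans _ _ (normc (V - 1) * normc Z))//.
    by rewrite ler_wpM2l ?normc_ge0.
  lra.
have gap t : `|t| <= C -> normc (g t) <= 1 / 8 -> normc (g t) <= 1 / 8 / 2.
  move=> tC /normc_le_cexpB1 /le_trans; apply; have := small _ tC; lra.
move=> t tC; rewrite -/(g t).
have gt : normc (g (0 + 1 * t)) <= 1 / 8 / 2.
  apply: (@normc_ivt_gap _ (fun x => g (0 + x * t))) => //.
  - have [a0 _ ua] := power_base aF m; have [b0 _ ub] := power_base bG m.
    have [c0 _ uc] := power_base cFG m.
    have := ucontD (ucontD (@ucont_affine _ _ 0 0 t (k m)%:R ua)
      (@ucont_affine _ _ 0 0 t (l m)%:R ub)) (@ucont_affine _ _ 0 0 t (- (r m)%:R) uc).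
    rewrite a0 b0 c0 => h; rewrite /g.
    by under eq_fun do rewrite -mulNr.
  - have [a0 _ _] := power_base aF m; have [b0 _ _] := power_base bG m.
    have [c0 _ _] := power_base cFG m.
    by rewrite /g mul0r addr0 a0 b0 c0 !subrr !mulr0 addr0 subr0.
  - move=> x /andP[x0 x1] h; apply: gap => //.
    by rewrite add0r normrM ger0_norm// (le_trans _ tC)// ler_piMl.
rewrite add0r mul1r in gt.
have /normc_le_cexpB1/le_trans : normc (g t) <= 1 / 8 by lra.
by apply; have := small _ tC; lra.
Unshelve. all: by end_near. Qed.

Lemma cvgc_cexp (w : nat -> R[i]) (k : nat -> nat) (p : R[i]) (B : R) :
  k @ \oo --> \oo -> (forall m, normc (w m) <= 1) -> 0 <= B ->
  (\forall m \near \oo, (k m)%:R * normc (w m - 1) <= B) ->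
  cvgc (fun m => w m ^+ k m) p -> cvgc (fun m => cexp ((k m)%:R * (w m - 1))) p.
Proof.
move=> koo w1 B0 kB wp; apply: (cvgc_shift0 wp) => e e0.
have k1 := near_nat_ge (2 * B + 1) koo.
have k2 := near_nat_ge (4 * B ^+ 2 / e) koo.
near=> m; rewrite subr0.
have k1_m : 2 * B + 1 <= (k m)%:R by near: m; exact: k1.
have k2_m : 4 * B ^+ 2 / e <= (k m)%:R by near: m; exact: k2.
have kB_m : (k m)%:R * normc (w m - 1) <= B by near: m; exact: kB.
move: kB_m k1_m k2_m; have := normc_ge0 (w m - 1) => x0 KB k1'.
have K0 : 0 < ((k m)%:R : R) by lra.
have small : normc (w m - 1) <= 1 / 2.
  have : (k m)%:R * normc (w m - 1) <= (k m)%:R * (1 / 2) by lra.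
  by rewrite ler_pM2l.
rewrite ler_pdivrMr// => k2'; rewrite (le_trans (normc_expr_cexp _ _ _))//.
move: (normc _) small K0 x0 KB k1' k2' => x; move: ((k m)%:R : R) => K x2 K0 x0 KB k1' k2'.
have : (K * x) ^+ 2 <= B ^+ 2 by rewrite ler_sqr ?nnegrE ?mulr_ge0// ltW.
move=> h; rewrite -(ler_pM2r K0).
have -> : 4 * K * x ^+ 2 * K = 4 * (K * x) ^+ 2 by ring.
lra.
Unshelve. all: by end_near. Qed.

(** For |w| <= 1 the real part of w - 1 is nonpositive, so all exponentials involved have modulus at
    most 1, and exponents with difference tending to 0 have exponentials with difference tending to
    0. *)
Lemma power_limit_mul (u v w : nat -> R[i]) (k l r : nat -> nat) (p q s : R[i]) (B : R) :
  k @ \oo --> \oo -> l @ \oo --> \oo -> r @ \oo --> \oo -> 0 <= B ->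
  (forall m, normc (u m) <= 1) -> (forall m, normc (v m) <= 1) ->
  (forall m, normc (w m) <= 1) ->
  (\forall m \near \oo, (k m)%:R * normc (u m - 1) <= B) ->
  (\forall m \near \oo, (l m)%:R * normc (v m - 1) <= B) ->
  (\forall m \near \oo, (r m)%:R * normc (w m - 1) <= B) ->
  cvgc (fun m => (k m)%:R * (u m - 1) + (l m)%:R * (v m - 1)
                 - (r m)%:R * (w m - 1)) 0 ->
  cvgc (fun m => u m ^+ k m) p -> cvgc (fun m => v m ^+ l m) q ->
  cvgc (fun m => w m ^+ r m) s -> s = p * q.
Proof.
move=> koo loo roo B0 u1 v1 w1 uB vB wB g0 up vq ws.
have {uB}up := cvgc_cexp koo u1 B0 uB up.
have {vB}vq := cvgc_cexp loo v1 B0 vB vq.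
have {wB}ws := cvgc_cexp roo w1 B0 wB ws.
have pq : cvgc (fun m => cexp ((k m)%:R * (u m - 1)) * cexp ((l m)%:R * (v m - 1))) (p * q).
  by apply: cvgc_prod => // m; exact: normc_cexp_le1.
apply: (cvgc_unique ws); apply: (cvgc_shift0 pq) => e e0.
(* 1/2 is the range of [cexp_quadratic], which yields |exp g - 1| <= |g| + 4 |g|^2 <= 5 |g| <= e. *)
have e5 : 0 < Num.min (1 / 2) (e / 5) by rewrite lt_min !divr_gt0.
near=> m; rewrite subr0 -cexpD.
have : normc ((k m)%:R * (u m - 1) + (l m)%:R * (v m - 1) - (r m)%:R * (w m - 1) - 0)
    <= Num.min (1 / 2) (e / 5) by near: m; exact: g0.
rewrite subr0 le_min; set x := (k m)%:R * (u m - 1) + _; set z := (r m)%:R * _.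
set g := x - z => /andP[h1 h2].
have -> : cexp x - cexp z = (cexp g - 1) * cexp z.
  by rewrite mulrBl mul1r -cexpD subrK.
rewrite normcM.
rewrite (@le_trans _ _ (normc (cexp g - 1)))//.
  by rewrite ler_piMr ?normc_ge0// normc_cexp_le1.
have := normc_triangle (cexp g - 1 - g) g; rewrite subrK => h.
have := cexp_quadratic h1; have := normc_ge0 g; nra.
Unshelve. all: by end_near. Qed.

End power_approximation.

(** * Expectations of bounded real functions *)

Section bounded_expectation.
Context {d : measure_display} {T : measurableType d} {R : realType}.
Implicit Types (P : probability T R) (f g : T -> R).

Definition bounded_measurable f :=
  measurable_fun [set: T] f /\ exists M : R, forall x, `|f x| <= M.

Lemma bounded_measurable_integrable P f :
  bounded_measurable f -> P.-integrable [set: T] (EFin \o f).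
Proof.
move=> [mf [M fM]]; apply: measurable_bounded_integrable => //.
  by apply: (le_lt_trans (probability_le1 P measurableT)); rewrite ltry.
exists M; split; first exact: num_real.
by move=> y My x _; exact: le_trans (fM x) (ltW My).
Qed.

Lemma bounded_measurable_cst (c : R) : bounded_measurable (fun=> c).
Proof. by split; [exact: measurable_cst|exists `|c|]. Qed.

Lemma bounded_measurableD f g : bounded_measurable f -> bounded_measurable g ->
  bounded_measurable (fun x => f x + g x).
Proof.
move=> [mf [M fM]] [mg [N gN]]; split; first exact: measurable_funD.
by exists (M + N) => x; rewrite (le_trans (ler_normD _ _))// lerD.
Qed.

Lemma bounded_measurableM f g : bounded_measurable f -> bounded_measurable g ->
  bounded_measurable (fun x => f x * g x).
Proof.
move=> [mf [M fM]] [mg [N gN]]; split; first exact: measurable_funM.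
by exists (M * N) => x; rewrite normrM ler_pM.
Qed.

Lemma Rintegral_bounded_le P f g : bounded_measurable f -> bounded_measurable g ->
  (forall x, f x <= g x) -> \int[P]_x f x <= \int[P]_x g x.
Proof.
by move=> bf bg fg; apply: le_Rintegral => //; exact: bounded_measurable_integrable.
Qed.

Lemma probability_Rintegral_cst P (c : R) : \int[P]_x c = c.
Proof. by rewrite Rintegral_cst// [X in fine X](probability_setT P) mulr1. Qed.

Lemma Rintegral_bounded_cvg P (f_ : nat -> T -> R) f (M : R) :
  (forall n, measurable_fun [set: T] (f_ n)) ->
  (forall n x, `|f_ n x| <= M) -> (forall x, f_ ^~ x @ \oo --> f x) ->
  bounded_measurable f /\
  (fun n => \int[P]_x f_ n x) @ \oo --> \int[P]_x f x.
Proof.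
move=> mf fM ff.
have mfl : measurable_fun [set: T] f.
  by apply: (measurable_fun_cvg mf) => x _; exact: ff.
have bf : bounded_measurable f.
  split=> //; exists M => x.
  have cfx : `|f_ n x| @[n --> \oo] --> `|f x| by apply: cvg_norm; exact: ff.
  by apply: (cvgr_to_le cfx); near=> n; exact: fM.
split=> //.
have [| | | | |_ _] := @dominated_convergence _ T R P setT measurableT
    (fun n => EFin \o f_ n) (EFin \o f) (cst M%:E).
- by move=> n; exact/measurable_EFinP.
- exact/measurable_EFinP.
- by apply: aeW => x _; apply: cvg_EFin; [near=> n|exact: ff].
- by have := bounded_measurable_integrable P (bounded_measurable_cst M).
- by apply: aeW => x n _; rewrite lee_fin.
move=> h; rewrite /Rintegral; apply: fine_cvg.
rewrite fineK//; apply: integrable_fin_num => //.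
exact: bounded_measurable_integrable.
Unshelve. all: by end_near. Qed.

Lemma Rintegral_eq_on P f g (S : set T) : measurable S -> P S = 1%E ->
  bounded_measurable f -> bounded_measurable g -> (forall x, S x -> f x = g x) ->
  \int[P]_x f x = \int[P]_x g x.
Proof.
move=> mS PS bf bg fg; rewrite /Rintegral; congr fine.
apply: ae_eq_integral => //.
- exact/measurable_EFinP/bf.1.
- exact/measurable_EFinP/bg.1.
exists (~` S); split; first exact: measurableC.
  by transitivity (1 - P S)%E; [exact: probability_setC|rewrite PS subee].
by move=> x /=; apply: contra_not => Sx _; rewrite fg.
Qed.

End bounded_expectation.

Lemma Rintegral_distribution d d' (T : measurableType d) (T' : measurableType d')
    (R : realType) (P : probability T R) (X : {mfun T >-> T'}) (f : T' -> R) :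
  bounded_measurable f ->
  \int[distribution P X]_y f y = \int[P]_x f (X x).
Proof.
move=> [mf [M fM]]; rewrite /Rintegral; congr fine.
apply: (@integral_pushforward _ _ _ _ _ X _ P setT (EFin \o f)) => //.
  exact/measurable_EFinP.
apply: (@bounded_measurable_integrable _ _ _ P (f \o X)); split.
  exact: measurableT_comp.
by exists M => x; exact: fM.
Qed.

Section fubini_bounded.
Context {d d' : measure_display} {T : measurableType d} {T' : measurableType d'}.
Context {R : realType} (P : probability T R) (Q : probability T' R).

Lemma Rintegral_product (f : T * T' -> R) : bounded_measurable f ->
  bounded_measurable (fun x => \int[Q]_y f (x, y)) /\
  \int[(P \x Q)%E]_z f z = \int[P]_x \int[Q]_y f (x, y).
Proof.
move=> bf; have [mf [M fM]] := bf.
have imf : (P \x Q)%E.-integrable setT (EFin \o f).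
  exact: (@bounded_measurable_integrable _ _ _ (P \x Q)%E).
have bfx x : bounded_measurable (fun y => f (x, y)).
  by split; [exact: measurableT_comp|exists M => y; exact: fM].
have FE x : (\int[Q]_y (f (x, y))%:E)%E = (\int[Q]_y f (x, y))%:E.
  rewrite /Rintegral fineK//; apply: integrable_fin_num => //.
  exact: (bounded_measurable_integrable _ (bfx x)).
split; last first.
  rewrite /Rintegral; congr fine.
  rewrite -(integral12_prod_meas1 imf); apply: eq_integral => x _.
  by rewrite -FE.
split.
  have := measurable_fubini_F imf; rewrite /fubini_F /=.
  under eq_fun do rewrite FE.
  by move/measurable_EFinP.
exists M => x; rewrite -[M](probability_Rintegral_cst Q).
apply: (le_trans (le_normr_Rintegral _ _)) => //.
  exact: bounded_measurable_integrable.
apply: Rintegral_bounded_le; last by move=> y; exact: fM.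
  split; first exact/measurableT_comp/(bfx x).1.
  by exists M => y; rewrite normr_id; exact: fM.
exact: bounded_measurable_cst.
Qed.

End fubini_bounded.

(** * Expectations of bounded complex functions *)

Section complex_expectation.
Context {d : measure_display} {T : measurableType d} {R : realType}.
Implicit Types (P : probability T R) (f g : T -> R[i]).

Definition cbounded_measurable f :=
  cmeasurable f /\ exists M : R, forall x, normc (f x) <= M.

Lemma cbounded_measurable_ReIm f : cbounded_measurable f ->
  bounded_measurable (fun x => complex.Re (f x)) /\
  bounded_measurable (fun x => complex.Im (f x)).
Proof.
move=> [[mRe mIm] [M fM]]; split; split=> //; exists M => x.
  exact: le_trans (ler_Re_normc _) _.
exact: le_trans (ler_Im_normc _) _.
Qed.

Lemma cbounded_measurable_cst (c : R[i]) : cbounded_measurable (fun=> c).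
Proof. by split; [exact: cmeasurable_cst|exists (normc c)]. Qed.

Lemma cbounded_measurableD f g : cbounded_measurable f -> cbounded_measurable g ->
  cbounded_measurable (fun x => f x + g x).
Proof.
move=> [mf [M fM]] [mg [N gN]]; split; first exact: cmeasurableD.
by exists (M + N) => x; rewrite (le_trans (normc_triangle _ _))// lerD.
Qed.

Lemma cbounded_measurableM f g : cbounded_measurable f -> cbounded_measurable g ->
  cbounded_measurable (fun x => f x * g x).
Proof.
move=> [mf [M fM]] [mg [N gN]]; split; first exact: cmeasurableM.
by exists (M * N) => x; rewrite normcM ler_pM ?normc_ge0.
Qed.

Lemma cbounded_measurableB f g : cbounded_measurable f -> cbounded_measurable g ->
  cbounded_measurable (fun x => f x - g x).
Proof.
move=> bf bg; have := cbounded_measurableD bf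
  (cbounded_measurableM (cbounded_measurable_cst (-1)) bg).
by under eq_fun do rewrite mulN1r.
Qed.

Lemma cbounded_measurable_sum (I : Type) (s : seq I) (F : I -> T -> R[i]) :
  (forall i, cbounded_measurable (F i)) ->
  cbounded_measurable (fun x => \sum_(i <- s) F i x).
Proof.
move=> bF; elim: s => [|i s ih].
  by under eq_fun do rewrite big_nil; exact: cbounded_measurable_cst.
by under eq_fun do rewrite big_cons; exact: cbounded_measurableD.
Qed.

Lemma cbounded_measurable_prod (I : Type) (s : seq I) (F : I -> T -> R[i]) :
  (forall i, cbounded_measurable (F i)) ->
  cbounded_measurable (fun x => \prod_(i <- s) F i x).
Proof.
move=> bF; elim: s => [|i s ih].
  by under eq_fun do rewrite big_nil; exact: cbounded_measurable_cst.
by under eq_fun do rewrite big_cons; exact: cbounded_measurableM.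
Qed.

Definition cE P f : R[i] :=
  (\int[P]_x complex.Re (f x)) +i* (\int[P]_x complex.Im (f x)).

Lemma eq_cE P f g : f =1 g -> cE P f = cE P g.
Proof. by move=> fg; congr cE; exact/funext. Qed.

Lemma cE_cst P (c : R[i]) : cE P (fun=> c) = c.
Proof. by rewrite /cE !probability_Rintegral_cst; case: c. Qed.

Lemma cED P f g : cbounded_measurable f -> cbounded_measurable g ->
  cE P (fun x => f x + g x) = cE P f + cE P g.
Proof.
move=> /cbounded_measurable_ReIm[f1 f2] /cbounded_measurable_ReIm[g1 g2].
rewrite /cE; apply/eqP; rewrite eq_complex /=; apply/andP; split; apply/eqP.
  rewrite -RintegralD//; try exact: bounded_measurable_integrable.
  by apply: eq_Rintegral => x _; case: (f x) (g x) => ? ? [].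
rewrite -RintegralD//; try exact: bounded_measurable_integrable.
by apply: eq_Rintegral => x _; case: (f x) (g x) => ? ? [].
Qed.

Lemma cEZ P (c : R[i]) f : cbounded_measurable f ->
  cE P (fun x => c * f x) = c * cE P f.
Proof.
move=> /cbounded_measurable_ReIm[f1 f2]; case: c => a b.
have Z k h : bounded_measurable h -> bounded_measurable (fun x => k * h x : R).
  by move=> bh; exact: bounded_measurableM (bounded_measurable_cst k) bh.
rewrite /cE; apply/eqP; rewrite eq_complex /=; apply/andP; split; apply/eqP.
  rewrite -!RintegralZl//; try exact: bounded_measurable_integrable.
  rewrite -RintegralB//; try exact/bounded_measurable_integrable/Z.
  by apply: eq_Rintegral => x _; case: (f x).
rewrite -!RintegralZl//; try exact: bounded_measurable_integrable.
rewrite -RintegralD//; try exact/bounded_measurable_integrable/Z.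
by apply: eq_Rintegral => x _; case: (f x).
Qed.

Lemma cEB P f g : cbounded_measurable f -> cbounded_measurable g ->
  cE P (fun x => f x - g x) = cE P f - cE P g.
Proof.
move=> bf bg; rewrite -[- cE P g]mulN1r -cEZ// -cED//.
  by apply: eq_cE => x; rewrite mulN1r.
by apply: cbounded_measurableM => //; exact: cbounded_measurable_cst.
Qed.

(* Multiplying f by the conjugate of its mean makes the mean real, so that only
   the pointwise bound on the real part is needed. *)
Lemma normc_cE_le_Rintegral P f (g : T -> R) :
  cbounded_measurable f -> bounded_measurable g ->
  (forall x, normc (f x) <= g x) -> normc (cE P f) <= \int[P]_x g x.
Proof.
move=> bf bg fg; set c := cE P f.
have [c0|c0] := eqVneq (normc c) 0.
  rewrite c0; apply: Rintegral_ge0 => x _; exact: le_trans (normc_ge0 _) (fg x).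
have cp : 0 < normc c by rewrite lt0r c0 normc_ge0.
have bcf : cbounded_measurable (fun x => c^*%C * f x).
  by apply: cbounded_measurableM => //; exact: cbounded_measurable_cst.
have nJ : normc c^*%C = normc c by case: (c) => a b /=; rewrite sqrrN.
rewrite -(ler_pM2l cp) -expr2.
have -> : normc c ^+ 2 = complex.Re (cE P (fun x => c^*%C * f x)).
  by rewrite cEZ// -/c sqr_normcE; case: (c) => a b /=; ring.
rewrite -RintegralZl//; last exact: bounded_measurable_integrable.
apply: Rintegral_bounded_le.
- exact: (cbounded_measurable_ReIm bcf).1.
- exact: bounded_measurableM (bounded_measurable_cst _) bg.
- move=> x; rewrite (le_trans (ler_norm _))// (le_trans (ler_Re_normc _))//.
  by rewrite normcM nJ ler_wpM2l ?normc_ge0.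
Qed.

Lemma normc_cE_le P f (M : R) : cbounded_measurable f ->
  (forall x, normc (f x) <= M) -> normc (cE P f) <= M.
Proof.
move=> bf fM; rewrite -[M](probability_Rintegral_cst P).
exact: normc_cE_le_Rintegral (bounded_measurable_cst M) fM.
Qed.

Lemma cE_eq_on P f g (S : set T) : measurable S -> P S = 1%E ->
  cbounded_measurable f -> cbounded_measurable g -> (forall x, S x -> f x = g x) ->
  cE P f = cE P g.
Proof.
move=> mS PS /cbounded_measurable_ReIm[f1 f2] /cbounded_measurable_ReIm[g1 g2] fg.
by rewrite /cE; congr Complex; apply: (Rintegral_eq_on mS) => // x Sx; rewrite fg.
Qed.

End complex_expectation.

Lemma cbounded_measurable_comp d d' (T : measurableType d) (T' : measurableType d')
    (R : realType) (X : T -> T') (f : T' -> R[i]) :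
  measurable_fun [set: T] X -> cbounded_measurable f ->
  cbounded_measurable (fun x => f (X x)).
Proof.
move=> mX [[m1 m2] [M fM]]; split; last by exists M => x; exact: fM.
by split; [exact: (measurableT_comp m1 mX)|exact: (measurableT_comp m2 mX)].
Qed.

Lemma cE_distribution d d' (T : measurableType d) (T' : measurableType d')
    (R : realType) (P : probability T R) (X : {mfun T >-> T'}) (f : T' -> R[i]) :
  cbounded_measurable f -> cE (distribution P X) f = cE P (fun x => f (X x)).
Proof.
move=> /cbounded_measurable_ReIm[f1 f2].
by rewrite /cE !Rintegral_distribution.
Qed.

Section fubini_cbounded.
Context {d d' : measure_display} {T : measurableType d} {T' : measurableType d'}.
Context {R : realType} (P : probability T R) (Q : probability T' R).

Lemma cE_product (f : T * T' -> R[i]) : cbounded_measurable f ->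
  cbounded_measurable (fun x => cE Q (fun y => f (x, y))) /\
  cE (P \x Q)%E f = cE P (fun x => cE Q (fun y => f (x, y))).
Proof.
move=> bf; have [_ [M fM]] := bf.
have [f1 f2] := cbounded_measurable_ReIm bf.
have [m1 E1] := Rintegral_product P Q f1; have [m2 E2] := Rintegral_product P Q f2.
split; last by rewrite /cE /= E1 E2.
split; first by split; [exact: m1.1|exact: m2.1].
exists M => x; apply: normc_cE_le => [|y]; last exact: fM.
exact: (cbounded_measurable_comp (pair1_measurable x) bf).
Qed.

Lemma cE_product_mul (f : T -> R[i]) (g : T' -> R[i]) :
  cbounded_measurable f -> cbounded_measurable g ->
  cE (P \x Q)%E (fun z => f z.1 * g z.2) = cE P f * cE Q g.
Proof.
move=> bf bg; rewrite (cE_product _).2.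
  rewrite mulrC -cEZ//; apply: eq_cE => x /=.
  by rewrite cEZ// mulrC.
by apply: cbounded_measurableM; exact: cbounded_measurable_comp.
Qed.

End fubini_cbounded.

(** * The unit circle, characters and weak limits *)

Section unit_circle.
Context {R : realType}.
Implicit Types x y : R.

Definition eit x : R[i] := cos x +i* sin x.

Lemma eit0 : eit 0 = 1.
Proof. by rewrite /eit cos0 sin0. Qed.

Lemma eitD x y : eit (x + y) = eit x * eit y.
Proof. by rewrite /eit cosD sinD; congr Complex; rewrite addrC. Qed.

Lemma normc_eit x : normc (eit x) = 1.
Proof. by rewrite /= cos2Dsin2 sqrtr1. Qed.

(** The Lipschitz bound comes from |e^(i u) - 1|^2 = 2 (1 - cos u) <= u^2. Taking the minimum with 2
    keeps the bound integrable for laws without moments. *)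
Lemma normc_eitB x y : normc (eit x - eit y) <= Num.min 2 `|x - y|.
Proof.
rewrite le_min; apply/andP; split.
  by rewrite (le_trans (normc_sub _ _))// !normc_eit.
rewrite -[eit x](_ : eit (x - y) * eit y = _); last by rewrite -eitD subrK.
rewrite -{2}[eit y]mul1r -mulrBl normcM normc_eit mulr1.
rewrite -ler_sqr ?nnegrE ?normc_ge0// real_normK ?num_real// sqr_normcE /= subr0.
have := cos2Dsin2 (x - y); have /andP[_] := onem_cos_le (x - y).
nra.
Qed.

Lemma cbounded_measurable_eit d (T : measurableType d) (f : T -> R) :
  measurable_fun [set: T] f -> cbounded_measurable (fun z => eit (f z)).
Proof.
move=> mf; split; last by exists 1 => x; rewrite normc_eit.
split; apply: (measurableT_comp _ mf); apply: continuous_measurable_fun.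
  exact: continuous_cos.
exact: continuous_sin.
Qed.

End unit_circle.

Section convolution_character.
Context {d : measure_display} {T : measurableType d} {R : realType}.
Variables (add : {mfun (T * T)%type >-> T}) (zero : T) (chi : T -> R[i]).
Hypotheses (bchi : cbounded_measurable chi) (chi0 : chi zero = 1)
  (chiD : forall p, chi (add p) = chi p.1 * chi p.2).

Lemma cE_convolution (mu nu : probability T R) :
  cE (convolution_of add mu nu) chi = cE mu chi * cE nu chi.
Proof.
rewrite /convolution_of cE_distribution// -cE_product_mul//.
exact: eq_cE.
Qed.

Lemma cE_convolution_pow (mu : probability T R) n :
  cE (convolution_pow_of add zero mu n) chi = cE mu chi ^+ n.
Proof.
elim: n => [|n ih]; last by rewrite /convolution_pow_of iterS cE_convolution ih exprS.
have [[m1 m2] _] := bchi.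
rewrite /convolution_pow_of /= /cE /Rintegral !integral_dirac//; try exact/measurable_EFinP.
by rewrite !diracT !mul1e /= expr0 -chi0; case: (chi zero).
Qed.

End convolution_character.

Lemma eq_cE_measure d (T : measurableType d) (R : realType) (P Q : probability T R)
  (f : T -> R[i]) : measure_eq P Q -> cE P f = cE Q f.
Proof.
move=> PQ; rewrite /cE /Rintegral; congr Complex; congr fine;
  by apply: eq_measure_integral => A mA _; exact: PQ.
Qed.

Lemma weakly_converges_Rintegral d (T : borelType d) (R : realType)
    (mu_ : nat -> probability T R) (mu : probability T R) (f : T -> R) :
  weakly_converges mu_ mu -> continuous f -> bounded_measurable f ->
  (fun n => \int[mu_ n]_x f x) @ \oo --> \int[mu]_x f x.
Proof.
move=> wmu cf [mf bf]; apply: fine_cvg; rewrite fineK; first exact: wmu.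
apply: integrable_fin_num => //; exact: (bounded_measurable_integrable _ (conj mf bf)).
Qed.

Lemma weakly_converges_cE d (T : borelType d) (R : realType)
    (mu_ : nat -> probability T R) (mu : probability T R) (f : T -> R[i]) :
  weakly_converges mu_ mu -> continuous (fun x => complex.Re (f x)) ->
  continuous (fun x => complex.Im (f x)) -> cbounded_measurable f ->
  cvgc (fun n => cE (mu_ n) f) (cE mu f).
Proof.
move=> wmu cRe cIm /cbounded_measurable_ReIm[bRe bIm] e e0.
have e2 : 0 < e / 2 by rewrite divr_gt0.
have /cvgrPdist_le/(_ _ e2) hRe := weakly_converges_Rintegral wmu cRe bRe.
have /cvgrPdist_le/(_ _ e2) hIm := weakly_converges_Rintegral wmu cIm bIm.
near=> n; rewrite (le_trans (normc_le_ReIm _))//= [leRHS]splitr lerD// distrC.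
  by near: n; exact: hRe.
by near: n; exact: hIm.
Unshelve. all: by end_near. Qed.

(** * Characteristic functions on the real line *)

Section characteristic_function.
Context {R : realType}.
Implicit Types (mu nu : probability R R) (s t : R).

Definition cf mu t : R[i] := cE mu (fun x => eit (t * x)).

Lemma cbounded_measurable_eitM t : cbounded_measurable (fun x : R => eit (t * x)).
Proof. by apply: cbounded_measurable_eit; exact: measurable_funM. Qed.

Lemma cf0 mu : cf mu 0 = 1.
Proof. by rewrite -[RHS](cE_cst mu); apply: eq_cE => x; rewrite mul0r eit0. Qed.

Lemma normc_cf_le1 mu t : normc (cf mu t) <= 1.
Proof.
by apply: normc_cE_le => [|x]; [exact: cbounded_measurable_eitM|rewrite normc_eit].
Qed.

Lemma cfN mu t : cf mu (- t) = (cf mu t)^*%C.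
Proof.
have /cbounded_measurable_ReIm[_ bIm] := cbounded_measurable_eitM t.
rewrite /cf /cE /=; congr Complex.
  by apply: eq_Rintegral => x _; rewrite mulNr cosN.
rewrite -mulN1r -RintegralZl//; last exact: bounded_measurable_integrable.
by apply: eq_Rintegral => x _; rewrite mulNr sinN mulN1r.
Qed.

(** A modulus of continuity for [cf mu], given as the integral of a bounded continuous function so
    that it passes to weak limits. *)
Definition tail_modulus mu (h : R) := \int[mu]_x Num.min 2 (h * `|x|).

Lemma bounded_measurable_tail (h : R) : 0 <= h ->
  bounded_measurable (fun x : R => Num.min 2 (h * `|x|)).
Proof.
move=> h0; split; last first.
  exists 2 => x; rewrite ger0_norm; first by rewrite ge_min lexx.
  by rewrite le_min ler0n mulr_ge0.
apply: measurable_minr; first exact: measurable_cst.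
by apply: measurable_funM; [exact: measurable_cst|
  apply: continuous_measurable_fun; exact: norm_continuous].
Qed.

Lemma normc_cfB_le mu s t (h : R) : `|s - t| <= h ->
  normc (cf mu s - cf mu t) <= tail_modulus mu h.
Proof.
move=> sth; have h0 : 0 <= h by exact: le_trans sth.
rewrite /cf -cEB; try exact: cbounded_measurable_eitM.
apply: normc_cE_le_Rintegral.
- by apply: cbounded_measurableB; exact: cbounded_measurable_eitM.
- exact: bounded_measurable_tail.
- move=> x; rewrite (le_trans (normc_eitB _ _))// -mulrBl normrM.
  rewrite le_min ge_min lexx/= ge_min; apply/orP; right.
  by rewrite ler_wpM2r.
Qed.

Lemma tail_modulus_small mu (e : R) : 0 < e ->
  exists2 h : R, 0 < h & tail_modulus mu h <= e.
Proof.
move=> e0; pose f n (x : R) : R := Num.min 2 (n.+1%:R^-1 * `|x|).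
have [||x|_] := @Rintegral_bounded_cvg _ _ _ mu f (cst 0) 2.
- by move=> n; have [] := @bounded_measurable_tail n.+1%:R^-1 _.
- move=> n x; rewrite ger0_norm; first by rewrite ge_min lexx.
  by rewrite le_min ler0n mulr_ge0.
- apply/cvgrPdist_le => d d0.
  near=> n; rewrite /f /= sub0r normrN ger0_norm; last first.
    by rewrite le_min ler0n mulr_ge0.
  rewrite ge_min; apply/orP; right; rewrite mulrC ler_pdivrMr// mulrC.
  rewrite -ler_pdivrMr// (@le_trans _ _ n%:R) ?ler_nat//.
  by near: n; exact: (@near_nat_ge _ id).
rewrite probability_Rintegral_cst => /cvgrPdist_le/(_ _ e0) lim.
near \oo => n; exists n.+1%:R^-1 => //; rewrite /tail_modulus.
have : `|0 - \int[mu]_x f n x| <= e by near: n; exact: lim.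
by rewrite sub0r normrN; apply: le_trans; exact: ler_norm.
Unshelve. all: by end_near. Qed.

Lemma chf_like_cf mu : chf_like (cf mu).
Proof.
split; [exact: cf0|exact: normc_cf_le1|move=> e /(tail_modulus_small mu)[h h0 he]].
by exists h => // s t /(normc_cfB_le mu)/le_trans; apply.
Qed.

Lemma cf_convR_pow mu n t : cf (convR_pow mu n) t = cf mu t ^+ n.
Proof.
apply: cE_convolution_pow; first exact: cbounded_measurable_eitM.
  by rewrite mulr0 eit0.
by move=> p; rewrite -eitD -mulrDr.
Qed.

Lemma cf_convR mu nu t : cf (convR mu nu) t = cf mu t * cf nu t.
Proof.
apply: cE_convolution; first exact: cbounded_measurable_eitM.
by move=> p; rewrite -eitD -mulrDr.
Qed.

(** Equicontinuity holds because [tail_modulus] at a fixed h converges along the convolution powers: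
    if it is at most e / 2 for the limit, it is eventually at most e. *)
Lemma power_approx_cf (mu_ : nat -> probability R R) (k : nat -> nat) mu :
  k @ \oo --> \oo -> weakly_converges (fun m => convR_pow (mu_ m) (k m)) mu ->
  power_approx (fun m => cf (mu_ m)) k (cf mu).
Proof.
move=> koo wmu; split=> //.
- by move=> m; exact: chf_like_cf.
- exact: chf_like_cf.
- move=> e e0; have e2 : 0 < e / 2 by rewrite divr_gt0.
  have [h h0 he] := tail_modulus_small mu e2; exists h => //.
  have ch : continuous (fun x : R => Num.min 2 (h * `|x|)).
    move=> x; apply: (@continuous_min _ _ (cst (2 : R)) (fun y : R => h * `|y|)).
      exact: cst_continuous.
    by apply: continuousM; [exact: cst_continuous|exact: norm_continuous].
  have /cvgrPdist_le/(_ _ e2) lim :=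
    weakly_converges_Rintegral wmu ch (bounded_measurable_tail (ltW h0)).
  near=> m => s t st; rewrite -!cf_convR_pow (le_trans (normc_cfB_le _ st))//.
  have : `|tail_modulus mu h - tail_modulus (convR_pow (mu_ m) (k m)) h| <= e / 2.
    by near: m; exact: lim.
  by rewrite ler_norml => /andP[] *; lra.
- move=> t; under eq_fun do rewrite -cf_convR_pow.
  apply: weakly_converges_cE => //; last exact: cbounded_measurable_eitM.
    move=> x; apply: (@continuous_comp _ _ _ ( *%R t) cos); first exact: mulrl_continuous.
    exact: continuous_cos.
  move=> x; apply: (@continuous_comp _ _ _ ( *%R t) sin); first exact: mulrl_continuous.
  exact: continuous_sin.
Unshelve. all: by end_near. Qed.

(** Symmetrization: |cf|^2 is the transform of the difference of two independent copies, and it is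
    real. *)
Lemma sqr_normc_cf mu t :
  normc (cf mu t) ^+ 2 = \int[(mu \x mu)%E]_z cos (t * (z.1 - z.2)) /\
  bounded_measurable (fun z : R * R => cos (t * (z.1 - z.2))).
Proof.
have bt : cbounded_measurable (fun z : R * R => eit (t * (z.1 - z.2))).
  apply: cbounded_measurable_eit; apply: measurable_funM; first exact: measurable_cst.
  by apply: measurable_funB; [exact: measurable_fst|exact: measurable_snd].
split; last exact: (cbounded_measurable_ReIm bt).1.
transitivity (complex.Re (cE (mu \x mu)%E (fun z => eit (t * (z.1 - z.2))))); last by [].
have -> : cE (mu \x mu)%E (fun z => eit (t * (z.1 - z.2))) = cf mu t * cf mu (- t).
  rewrite -[RHS]cE_product_mul; try exact: cbounded_measurable_eitM.
  by apply: eq_cE => z; rewrite -eitD mulrBr mulNr.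
by rewrite cfN sqr_normcE; case: (cf mu t) => a b /=; ring.
Qed.

(** Integrated form of cos (2 x) + 3 - 4 cos x = 2 (1 - cos x)^2 >= 0. *)
Lemma onem_sqr_cf_double mu t :
  1 - normc (cf mu (2 * t)) ^+ 2 <= 4 * (1 - normc (cf mu t) ^+ 2).
Proof.
have [-> b2] := sqr_normc_cf mu (2 * t); have [-> b1] := sqr_normc_cf mu t.
suff : 4 * \int[(mu \x mu)%E]_z cos (t * (z.1 - z.2)) + (-3) <=
  \int[(mu \x mu)%E]_z cos (2 * t * (z.1 - z.2)) by lra.
have b4 : bounded_measurable (fun z : R * R => 4 * cos (t * (z.1 - z.2))).
  exact: bounded_measurableM (bounded_measurable_cst _) b1.
rewrite -RintegralZl//; last exact: (@bounded_measurable_integrable _ _ _ (mu \x mu)%E).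
rewrite -(probability_Rintegral_cst (mu \x mu)%E (-3)) -RintegralD//; last 2 first.
- exact: (@bounded_measurable_integrable _ _ _ (mu \x mu)%E).
- apply: (@bounded_measurable_integrable _ _ _ (mu \x mu)%E).
  exact: bounded_measurable_cst.
apply: (@Rintegral_bounded_le _ _ _ (mu \x mu)%E) => //.
  exact: bounded_measurableD b4 (bounded_measurable_cst _).
move=> z; rewrite -mulrA; set x := t * _.
have -> : 2 * x = x *+ 2 by rewrite mulr2n; ring.
rewrite cos_mulr2n [cos x ^+ 2 *+ 2]mulr2n; have := sqr_ge0 (cos x - 1); nra.
Qed.

(** In the induction, the two sides of the step differ by (n + 1) (1 - x)^2. The bound makes x^n of
    order 1 / n for x < 1; it serves both the absence of zeros and the step polynomials. *)
Lemma expr_onem_le (x : R) n : 0 <= x -> x ^+ n * (1 + n%:R * (1 - x)) <= 1.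
Proof.
move=> x0; elim: n => [|n ih]; first by rewrite expr0 mul0r addr0 mul1r.
apply: le_trans ih; rewrite exprSr -mulrA ler_wpM2l ?exprn_ge0//.
rewrite -[n.+1]addn1 natrD; have := sqr_ge0 (1 - x); have := ler0n R n; nra.
Qed.

(* The n-th roots of mu have 1 - |cf|^2 = O(1/n) wherever cf mu does not vanish,
   and doubling the argument multiplies this quantity at most by 4. *)
Lemma cf_double_neq0 mu t : infinitely_divisible mu ->
  cf mu t != 0 -> cf mu (2 * t) != 0.
Proof.
move=> mu_id p0; set p := normc (cf mu t) ^+ 2.
have pp : 0 < p.
  rewrite /p exprn_gt0// lt0r normc_ge0 andbT; apply: contra p0 => /eqP/eq0_normc ->.
  by [].
(* A zero at 2 t would give 1 - x >= 1/4 for x = |cf nu t|^2, where p = x^n; then p n / 4 <= p n (1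
   - x) <= 1 - p < 1, which n > 4 / p excludes. *)
have [n np n1] : exists2 n : nat, 4 / p < n%:R & (1 <= n)%N.
  by exists (Num.truncn (4 / p)).+1 => //; exact: truncnS_gt.
have [nu nuE] := mu_id n n1.
have cfE s : cf mu s = cf nu s ^+ n.
  by rewrite -cf_convR_pow; apply: eq_cE_measure => A mA; rewrite nuE.
have := onem_sqr_cf_double nu t.
set x := normc (cf nu t) ^+ 2; set y := normc (cf nu _) ^+ 2 => yx.
have px : p = x ^+ n by rewrite /p cfE normcX -!exprM mulnC.
have := @expr_onem_le x n (sqr_ge0 _); rewrite -px.
move: np; rewrite ltr_pdivrMr// => np h.
suff : y != 0.
  rewrite cfE; apply: contra; rewrite expf_eq0 => /andP[_ /eqP]; rewrite /y => ->.
  by rewrite normc0 expr0n.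
apply/eqP => y0; rewrite y0 in yx.
have : p * n%:R * (1 / 4) <= p * n%:R * (1 - x).
  have pn0 : 0 <= p * n%:R by rewrite mulr_ge0 ?ler0n ?(ltW pp).
  by rewrite ler_wpM2l//; lra.
lra.
Qed.

(** By continuity there is no zero near 0, and t is reached from t / 2^n by n doublings. *)
Lemma cf_neq0 mu : infinitely_divisible mu -> forall t, cf mu t != 0.
Proof.
move=> mu_id t; have [_ _ uc] := chf_like_cf mu.
have [h h0 hP] := uc (1 / 2) (divr_gt0 ltr01 (ltr0Sn _ 1)).
have small s : `|s| <= h -> cf mu s != 0.
  move=> sh; have := hP s 0; rewrite subr0 cf0 => /(_ sh) h1.
  apply/eqP => s0; move: h1; rewrite s0 sub0r normc_opp normc1; lra.
have dbl n : `|t / 2 ^+ n| <= h -> cf mu t != 0.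
  elim: n t {hP} => [|n ih] s; first by rewrite expr0 divr1; exact: small.
  move=> sh; have -> : s = 2 * (s / 2) by rewrite mulrC divfK.
  by apply: cf_double_neq0 => //; apply: ih; rewrite -mulrA -invfM -exprS.
apply: (dbl (Num.truncn (`|t| / h)).+1).
rewrite normrM normfV [X in _ / X]ger0_norm ?exprn_ge0//.
rewrite ler_pdivrMr ?exprn_gt0// mulrC -ler_pdivrMr//.
rewrite (le_trans (ltW (truncnS_gt _)))//; move: (_.+1) => n.
by rewrite -natrX ler_nat ltnW// ltn_expl.
Qed.

End characteristic_function.

Lemma cE_iid_law (R : realType) (mu : probability R R) n (s : 'I_n -> R) :
  cE (iid_law mu n) (fun x => eit (\sum_(j < n) s j * tnth x j)) =
  \prod_(j < n) cf mu (s j).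
Proof.
have bs m (r : 'I_m -> R) :
    cbounded_measurable (fun x : m.-tuple R => eit (\sum_(j < m) r j * tnth x j)).
  apply: cbounded_measurable_eit; apply: measurable_sum => j.
  by apply: measurable_funM; [exact: measurable_cst|exact: measurable_tnth].
elim: n s => [|n ih] s.
  rewrite big_ord0 -[RHS](cE_cst (iid_law mu 0)).
  by apply: eq_cE => x; rewrite big_ord0 eit0.
rewrite /= cE_distribution; last exact: bs.
rewrite big_ord_recl -ih.
rewrite -cE_product_mul; [|exact: cbounded_measurable_eitM|exact: bs].
apply: eq_cE => -[x y] /=; rewrite big_ord_recl eitD; congr (_ * eit _).
by apply: eq_bigr => j _; rewrite !(tnth_nth 0).
Qed.

(** * Polynomials approximating a step function *)

Section indicator_approximation.
Context {R : realType}.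
Implicit Types (p y : R) (n : nat).

(* Approximates the indicator of p < 1/2 on [0, 1]: the product
   n * 4 ^ n * p ^+ (2 * n) = n * (2 * p) ^+ (2 * n) tends to 0 if p < 1/2 and to
   infinity otherwise, the factor n taking care of p = 1/2. *)
Definition step_poly n p : R := (1 - p ^+ (2 * n)) ^+ (n * 4 ^ n).

Lemma step_poly_bound n p : 0 <= p <= 1 -> `|step_poly n p| <= 1.
Proof.
move=> /andP[p0 p1]; rewrite /step_poly normrX exprn_ile1// ger0_norm.
  by rewrite gerBl exprn_ge0.
by rewrite subr_ge0 exprn_ile1.
Qed.

Lemma bernoulli_onem (q : R) n : 0 <= q <= 1 -> 1 - n%:R * q <= (1 - q) ^+ n.
Proof.
move=> /andP[q0 q1]; elim: n => [|n ih]; first by rewrite mul0r subr0 expr0.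
rewrite exprS -[n.+1]addn1 natrD.
have := ler0n R n; have q2 : 0 <= 1 - q by rewrite subr_ge0.
have := ler_wpM2l q2 ih; nra.
Qed.

(** Used with A = r^n, N = n and x = 1 - r: the first inequality gives A <= 1 / (N x), hence N A^2
    <= 1 / (N x^2). *)
Let step_error_lt (A N x e : R) : 0 <= A -> 0 <= N -> 0 < x -> 0 < e ->
  A * (1 + N * x) <= 1 -> 1 <= N * (e * x * x) -> N * A ^+ 2 <= e.
Proof.
move=> A0 N0 x0 e0; rewrite mulrDr mulr1 => h h'.
have eNx : N * (e * x * x) = e * x * (N * x) by ring.
have Nx : 0 < N * x.
  rewrite lt0r mulr_ge0 ?(ltW x0)// andbT; apply/eqP => Nx0.
  by move: h'; rewrite eNx Nx0 mulr0 ler10.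
have A1 : A * (N * x) <= 1 by lra.
have A2 : (A * (N * x)) ^+ 2 <= 1 by rewrite exprn_ile1// mulr_ge0// ltW.
have NNx : 0 < N * x * x by rewrite mulr_gt0.
rewrite -(ler_pM2r NNx).
have -> : N * A ^+ 2 * (N * x * x) = (A * (N * x)) ^+ 2 by ring.
by apply: le_trans A2 _; lra.
Qed.

Let step_error_ge (s A N e : R) : 0 <= N -> 0 <= s -> s * (1 + N * A) <= 1 -> 1 <= A ->
  1 <= N * e -> s <= e.
Proof.
move=> N0 s0 h A1 Ne.
have N1 : 0 < N by rewrite lt0r N0 andbT; apply/eqP => N1; move: Ne; rewrite N1 mul0r; lra.
have h1 : s * N <= s * (N * A) by rewrite ler_wpM2l// ler_peMr.
rewrite -(ler_pM2r N1) mulrC [e * N]mulrC.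
by rewrite mulrDr mulr1 in h; lra.
Qed.

(** With r = 2 p, Bernoulli's inequality bounds the polynomial below by 1 - n r^(2 n), which settles
    r < 1. For r >= 1, [expr_onem_le] bounds it above by 1 / (1 + n r^(2 n)) <= 1 / (1 + n). *)
Lemma step_poly_cvg p : 0 <= p <= 1 ->
  (fun n => step_poly n p) @ \oo --> ((p < 1 / 2)%R%:R : R).
Proof.
move=> /andP[p0 p1]; pose r := 2 * p.
have r0 : 0 <= r by rewrite mulr_ge0.
have q01 n : 0 <= p ^+ (2 * n) <= 1 by rewrite exprn_ge0// exprn_ile1.
have Nq n : (n * 4 ^ n)%:R * p ^+ (2 * n) = n%:R * (r ^+ n) ^+ 2.
  rewrite natrM natrX -mulrA; congr (_ * _).
  rewrite exprM -exprMn -exprM mulnC exprM; congr (_ ^+ n).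
  by rewrite /r exprMn; congr (_ * _); ring.
apply/cvgrPdist_le => e e0; have [rlt|rge] := ltP p (1 / 2).
- have d0 : 0 < 1 - r by rewrite /r; lra.
  near=> n; have /andP[b0 b1] := q01 n.
  have h1 := bernoulli_onem (n * 4 ^ n) (q01 n).
  have h2 : step_poly n p <= 1.
    by rewrite (le_trans (ler_norm _))// step_poly_bound// p0.
  rewrite ger0_norm ?subr_ge0// lerBlDr -lerBlDl; apply: le_trans h1.
  rewrite lerB// Nq.
  have := expr_onem_le n r0; have : 0 <= r ^+ n by rewrite exprn_ge0.
  have : (e * (1 - r) * (1 - r))^-1 <= n%:R by near: n; exact: (@near_nat_ge _ id).
  rewrite -[_^-1]mul1r ler_pdivrMr ?mulr_gt0// => h A0 h3.
  exact: (step_error_lt A0 (ler0n R n) d0 e0 h3 h).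
- near=> n; have /andP[b0 b1] := q01 n.
  have s0 : 0 <= 1 - p ^+ (2 * n) by rewrite subr_ge0.
  have := expr_onem_le (n * 4 ^ n) s0; rewrite subKr Nq -/(step_poly n p).
  have h0 : 0 <= step_poly n p by rewrite exprn_ge0.
  rewrite sub0r normrN ger0_norm//.
  have r1 : 1 <= r by rewrite /r; lra.
  have : 1 <= (r ^+ n) ^+ 2 by rewrite !exprn_ege1.
  have : e^-1 <= n%:R by near: n; exact: (@near_nat_ge _ id).
  rewrite -[e^-1]mul1r ler_pdivrMr//.
  move=> h1 A1 h2; exact: (step_error_ge (ler0n R n) h0 h2 A1 h1).
Unshelve. all: by end_near. Qed.

End indicator_approximation.

(** * Equality of measures on half-spaces from equality of Fourier transforms *)

Section trigonometric_uniqueness.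
Context {d : measure_display} {T : measurableType d} {R : realType}.
Variables (P Q : probability T R) (Lin : set (T -> R)).
Hypothesis LinD : forall f g, Lin f -> Lin g -> Lin (fun x => f x + g x).
Hypothesis LinZ : forall (c : R) f, Lin f -> Lin (fun x => c * f x).
Hypothesis measurable_Lin : forall f, Lin f -> measurable_fun [set: T] f.
Hypothesis eq_char : forall f, Lin f ->
  cE P (fun x => eit (f x)) = cE Q (fun x => eit (f x)).

Let bcos f (th : R) : Lin f -> bounded_measurable (fun x => cos (f x + th)).
Proof.
move=> Lf; split; last by exists 1 => x; exact: cos_max.
apply: (@measurableT_comp _ _ _ _ _ _ cos).
  by apply: continuous_measurable_fun; exact: continuous_cos.
by apply: measurable_funD; [exact: measurable_Lin|exact: measurable_cst].
Qed.

(* Tests for equality of P and Q; the weights cos (f + th) make the class stable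
   under multiplication by trigonometric polynomials. *)
Definition agree (g : T -> R) := bounded_measurable g /\
  forall f th, Lin f ->
    \int[P]_x (g x * cos (f x + th)) = \int[Q]_x (g x * cos (f x + th)).

Lemma agree_ext g g' : g =1 g' -> agree g -> agree g'.
Proof. by move=> /funext ->. Qed.

Lemma agree1 : agree (fun=> 1).
Proof.
split=> [|f th Lf]; first exact: bounded_measurable_cst.
have /cbounded_measurable_ReIm[b1 b2] := cbounded_measurable_eit (measurable_Lin Lf).
have E (mu : probability T R) : \int[mu]_x (1 * cos (f x + th)) =
    cos th * complex.Re (cE mu (fun x => eit (f x))) -
    sin th * complex.Im (cE mu (fun x => eit (f x))).
  rewrite /= -!RintegralZl//; try exact: bounded_measurable_integrable.
  rewrite -RintegralB//; try (apply: bounded_measurable_integrable;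
    exact: bounded_measurableM (bounded_measurable_cst _) _).
  by apply: eq_Rintegral => x _; rewrite mul1r cosD mulrC [sin (f x) * _]mulrC.
by rewrite !E eq_char.
Qed.

Lemma agreeD g h : agree g -> agree h -> agree (fun x => g x + h x).
Proof.
move=> [bg Eg] [bh Eh]; split=> [|f th Lf]; first exact: bounded_measurableD.
have E (mu : probability T R) : \int[mu]_x ((g x + h x) * cos (f x + th)) =
    \int[mu]_x (g x * cos (f x + th)) + \int[mu]_x (h x * cos (f x + th)).
  rewrite -RintegralD//; try (apply: bounded_measurable_integrable;
    exact: bounded_measurableM (bcos _ Lf)).
  by apply: eq_Rintegral => x _; rewrite mulrDl.
by rewrite !E Eg// Eh.
Qed.

Lemma agreeZ (c : R) g : agree g -> agree (fun x => c * g x).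
Proof.
move=> [bg Eg]; split=> [|f th Lf].
  exact: bounded_measurableM (bounded_measurable_cst _) bg.
have E (mu : probability T R) : \int[mu]_x (c * g x * cos (f x + th)) =
    c * \int[mu]_x (g x * cos (f x + th)).
  rewrite -RintegralZl//; try (apply: bounded_measurable_integrable;
    exact: bounded_measurableM (bcos _ Lf)).
  by apply: eq_Rintegral => x _; rewrite mulrA.
by rewrite !E Eg.
Qed.

(** The product of two cosines is half the sum of the cosines of the sum and of the difference, and
    [Lin] is closed under both. *)
Lemma agree_cos f th g : Lin f -> agree g -> agree (fun x => g x * cos (f x + th)).
Proof.
move=> Lf [bg Eg]; split=> [|h ph Lh]; first exact: bounded_measurableM (bcos _ Lf).
have LD : Lin (fun x => f x + h x) by exact: LinD.
have LB : Lin (fun x => f x + (-1) * h x) by apply: LinD => //; exact: LinZ.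
have E (mu : probability T R) : \int[mu]_x (g x * cos (f x + th) * cos (h x + ph)) =
    1 / 2 * \int[mu]_x (g x * cos ((f x + h x) + (th + ph))) +
    1 / 2 * \int[mu]_x (g x * cos ((f x + (-1) * h x) + (th - ph))).
  rewrite -!RintegralZl//; try (apply: bounded_measurable_integrable;
    exact: bounded_measurableM (bcos _ _)).
  rewrite -RintegralD//; try (apply: bounded_measurable_integrable;
    apply: bounded_measurableM (bounded_measurable_cst _) _;
    exact: bounded_measurableM (bcos _ _)).
  apply: eq_Rintegral => x _.
  have -> : f x + h x + (th + ph) = (f x + th) + (h x + ph) by ring.
  have -> : f x + (-1) * h x + (th - ph) = (f x + th) - (h x + ph) by ring.
  by move: (f x + th) (h x + ph) => u v; rewrite cosB cosD; field.
by rewrite !E Eg// Eg.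
Qed.

Lemma agree_expr f th g n : Lin f -> agree g ->
  agree (fun x => g x * ((1 + cos (f x + th)) / 2) ^+ n).
Proof.
move=> Lf ag; elim: n => [|n ih].
  by apply: agree_ext ag => x; rewrite expr0 mulr1.
have := agreeZ (1 / 2) (agreeD ih (agree_cos th Lf ih)).
by apply: agree_ext => x; rewrite exprSr; field.
Qed.

Lemma agree_step_poly f th g n : Lin f -> agree g ->
  agree (fun x => g x * step_poly n ((1 + cos (f x + th)) / 2)).
Proof.
move=> Lf ag; rewrite /step_poly; elim: (n * 4 ^ n)%N => [|N ih].
  by apply: agree_ext ag => x; rewrite expr0 mulr1.
have := agreeD ih (agreeZ (-1) (agree_expr th (2 * n) Lf ih)).
by apply: agree_ext => x; rewrite exprSr; ring.
Qed.

Lemma agree_cvg (g_ : nat -> T -> R) g (M : R) : (forall n, agree (g_ n)) ->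
  (forall n x, `|g_ n x| <= M) -> (forall x, g_ ^~ x @ \oo --> g x) -> agree g.
Proof.
move=> ag gM gg.
have mg n : measurable_fun [set: T] (g_ n) by have [[]] := ag n.
split=> [|f th Lf]; first exact: (Rintegral_bounded_cvg P mg gM gg).1.
have cvgI (mu : probability T R) : (fun n => \int[mu]_x (g_ n x * cos (f x + th))) @ \oo -->
    \int[mu]_x (g x * cos (f x + th)).
  apply: (Rintegral_bounded_cvg mu (M := M) _ _ _).2.
  - by move=> n; apply: measurable_funM => //; exact: (bcos th Lf).1.
  - by move=> n x; rewrite normrM (le_trans _ (gM n x))// ler_piMr// cos_max.
  - by move=> x; apply: cvgM; [exact: gg|exact: cvg_cst].
rewrite -(cvg_lim (@Rhausdorff R) (cvgI P)) -(cvg_lim (@Rhausdorff R) (cvgI Q)).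
congr (lim (_ @ \oo)); apply/funext => n; exact: (ag n).2.
Qed.

(** The affine change (1 + cos) / 2 maps the cosine into [0, 1] and its sign change to the threshold
    1/2 of [step_poly]. *)
Lemma agree_cos_lt0 f th g : Lin f -> agree g ->
  agree (fun x => g x * (cos (f x + th) < 0)%R%:R).
Proof.
move=> Lf ag; have [_ [M gM]] := ag.1.
have p01 x : 0 <= (1 + cos (f x + th)) / 2 <= 1.
  by have := cos_geN1 (f x + th); have := cos_le1 (f x + th) => *; lra.
apply: (@agree_cvg _ _ M (fun n => agree_step_poly th n Lf ag)).
  move=> n x; rewrite normrM (le_trans _ (gM x))// ler_piMr//.
  exact: step_poly_bound.
move=> x; apply: cvgM; first exact: cvg_cst.
have -> : (cos (f x + th) < 0) = ((1 + cos (f x + th)) / 2 < 1 / 2).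
  by apply/idP/idP => h; lra.
exact: step_poly_cvg.
Qed.

Lemma agree_lt f (a : R) g : Lin f -> agree g ->
  agree (fun x => g x * (f x < a)%R%:R).
Proof.
move=> Lf ag; have [_ [M gM]] := ag.1.
(* cos (- (f - a) / n.+1 + pi / 2) = sin ((f - a) / n.+1) has the sign of f - a
   as soon as |f - a| < pi * n.+1. *)
have ag_ n := agree_cos_lt0 (n.+1%:R^-1 * a + pi / 2) (LinZ (- n.+1%:R^-1) Lf) ag.
apply: (agree_cvg (M := M) ag_).
  move=> n x; rewrite normrM (le_trans _ (gM x))// ler_piMr//.
  by case: (_ < 0); rewrite ?normr1 ?normr0.
move=> x; apply: cvgM; first exact: cvg_cst.
apply: cvg_near_cst; near=> n; congr (_%:R); congr nat_of_bool.
have -> : - n.+1%:R^-1 * f x + (n.+1%:R^-1 * a + pi / 2) =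
   (- ((f x - a) / n.+1%:R)) + pi / 2 by ring.
rewrite cosDpihalf sinN opprK.
have : `|f x - a| / pi < n.+1%:R.
  rewrite (@le_lt_trans _ _ n%:R) ?ltr_nat//.
  by near: n; exact: (@near_nat_ge _ id).
rewrite ltr_pdivrMr ?pi_gt0// mulrC -ltr_pdivrMr// -[X in _ / X]ger0_norm// -normfV.
rewrite -normrM; set v := (f x - a) / _ => vpi.
have vE : (f x < a) = (v < 0) by rewrite /v pmulr_llt0 ?invr_gt0// subr_lt0.
rewrite vE; move: vpi; have [v0|v0|->] := ltgtP v 0; last by rewrite sin0 ltxx.
- rewrite ltr0_norm// => vpi; rewrite -oppr_gt0 -sinN sin_gt0_pi//.
  by rewrite oppr_gt0 v0.
- by rewrite gtr0_norm// => vpi; rewrite ltNge ltW// sin_gt0_pi// v0.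
Unshelve. all: by end_near. Qed.

Lemma eq_probability_lt (I : finType) (f : I -> T -> R) (a : I -> R) :
  Lin (fun=> 0) -> (forall i, Lin (f i)) ->
  P [set x | forall i, f i x < a i] = Q [set x | forall i, f i x < a i].
Proof.
move=> Lin0 Lf; set A := [set x | _].
have mlt i : measurable [set x | f i x < a i].
  rewrite (_ : [set x | _] = setT `&` f i @^-1` [set` `]-oo, a i[]); last first.
    by rewrite setTI; apply/seteqP; split => x /=; rewrite in_itv.
  by apply: (measurable_Lin (Lf i)) => //; exact: measurable_itv.
have mA : measurable A.
  rewrite (_ : A = \bigcap_(i in [set: I]) [set x | f i x < a i]); last first.
    by apply/seteqP; split => [x Ax i _|x Ax i]; [exact: Ax|exact: Ax].
  by apply: fin_bigcap_measurable => //; exact: finite_finset.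
have agA : agree (fun x => \1_A x).
  apply: (@agree_ext (fun x => \prod_(i <- enum I) (f i x < a i)%R%:R)).
    move=> x; rewrite indicE; have [/set_mem xA|/negP xA] := boolP (x \in A).
      by rewrite big1_seq// => i _; rewrite xA.
    have [i /negbTE fi] : exists i, ~~ (f i x < a i).
      apply: contrapT => h; apply: xA; rewrite inE => i.
      by apply: contrapT => /negP fi; apply: h; exists i.
    by rewrite (bigD1_seq i) ?enum_uniq ?mem_enum//= fi mul0r.
  elim: (enum I) => [|i s ih].
    by apply: agree_ext agree1 => x; rewrite big_nil.
  by apply: agree_ext (agree_lt (a i) (Lf i) ih) => x; rewrite big_cons mulrC.
(* The zero functional with phase 0 gives the weight cos 0 = 1, that is, the plain integrals. *)
have := agA.2 _ 0 Lin0; under eq_Rintegral do rewrite addr0 cos0 mulr1.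
under [in RHS]eq_Rintegral do rewrite addr0 cos0 mulr1.
rewrite /Rintegral !integral_indic// !setIT => PQ.
by rewrite -[LHS]fineK ?fin_num_measure// PQ fineK ?fin_num_measure.
Qed.

End trigonometric_uniqueness.

(** * Means of products of characteristic functions at random points *)

Section mixed_characters.
Context {d : measure_display} {Z : measurableType d} {R : realType}.
Variables (Q : probability Z R) (n : nat) (s : 'I_n -> Z -> R).
Hypothesis ms : forall j, measurable_fun [set: Z] (s j).
Implicit Types mu nu : probability R R.

(** The composite is a partial integral of a bounded function on [Z * R], so its measurability is
    part of Fubini's theorem. *)
Lemma cbounded_measurable_cf_comp mu j : cbounded_measurable (fun z => cf mu (s j z)).
Proof.
apply: (@cE_product _ _ _ _ _ Q mu (fun p : Z * R => eit (s j p.1 * p.2)) _).1.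
apply: cbounded_measurable_eit; apply: measurable_funM; last exact: measurable_snd.
exact: measurableT_comp (ms j) measurable_fst.
Qed.

(** When [Q] is the law of the unitary factors and [s] the family of weights attached to A, this is
    the Fourier transform at A of one summand of the matrix model. *)
Definition mixed_cf mu : R[i] := cE Q (fun z => \prod_(j < n) cf mu (s j z)).

Lemma cbounded_measurable_prod_cf mu :
  cbounded_measurable (fun z => \prod_(j < n) cf mu (s j z)).
Proof. by apply: cbounded_measurable_prod => j; exact: cbounded_measurable_cf_comp. Qed.

Lemma normc_mixed_cf_le1 mu : normc (mixed_cf mu) <= 1.
Proof.
apply: normc_cE_le => [|z]; first exact: cbounded_measurable_prod_cf.
by have [] := @normc_prodB1 _ _ (index_enum 'I_n) (fun j => cf mu (s j z))
  (fun j => normc_cf_le1 _ _).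
Qed.

Variable C : R.
Hypothesis sC : forall j z, `|s j z| <= C.

Section one_sequence.
Variables (mu_ : nat -> probability R R) (k : nat -> nat) (F : R -> R[i]).
Hypotheses (muF : power_approx (fun m => cf (mu_ m)) k F) (F_neq0 : forall t, F t != 0).

(** The n deviations from 1 sum to at most n B / k, so the product differs from its linear part by
    at most (n B / k)^2. One factor k is kept on the left, so that the second bound expresses an
    error of order 1 / k after rescaling. *)
Lemma mixed_cf_linear : exists2 B : R, 0 <= B &
  \forall m \near \oo, (k m)%:R * normc (mixed_cf (mu_ m) - 1) <= B /\
    (k m)%:R * normc ((k m)%:R * (mixed_cf (mu_ m) - 1) -
      cE Q (fun z => \sum_(j < n) (k m)%:R * (cf (mu_ m) (s j z) - 1))) <= B ^+ 2.
Proof.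
have [B B0 kB] := power_bounded muF F_neq0 C.
exists (n%:R * B); first by rewrite mulr_ge0.
near=> m.
have kB_m : forall t, `|t| <= C -> (k m)%:R * normc (cf (mu_ m) t - 1) <= B.
  by near: m; exact: kB.
set K := ((k m)%:R : R[i]).
pose u j z := cf (mu_ m) (s j z).
have bu j : cbounded_measurable (u j) by exact: cbounded_measurable_cf_comp.
have bp : cbounded_measurable (fun z => \prod_(j < n) u j z).
  exact: cbounded_measurable_prod_cf.
have b1 (c : R[i]) : cbounded_measurable (fun _ : Z => c) by exact: cbounded_measurable_cst.
have prodB z := @normc_prodB1 _ _ (index_enum 'I_n) (u ^~ z)
  (fun j => normc_cf_le1 _ _).
have sumB z : (k m)%:R * (\sum_(j < n) normc (u j z - 1)) <= n%:R * B.
  rewrite mulr_sumr (le_trans (ler_sum _ (fun j _ => kB_m _ (sC j z))))//.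
  by rewrite sumr_const card_ord mulr_natl.
have m1 : mixed_cf (mu_ m) - 1 = cE Q (fun z => \prod_(j < n) u j z - 1).
  by rewrite cEB// cE_cst.
have nK : normc K = (k m)%:R by exact: normc_nat.
have k0 : 0 <= ((k m)%:R : R) by [].
split.
  rewrite -nK -normcM m1 -cEZ//; last exact: cbounded_measurableB.
  apply: normc_cE_le => [|z]; first exact: cbounded_measurableM (b1 _)
    (cbounded_measurableB bp (b1 1)).
  rewrite normcM nK (le_trans _ (sumB z))// ler_wpM2l//.
  by have [] := prodB z.
have bs : cbounded_measurable (fun z => \sum_(j < n) (u j z - 1)).
  by apply: cbounded_measurable_sum => j; exact: cbounded_measurableB.
have -> : cE Q (fun z => \sum_(j < n) K * (cf (mu_ m) (s j z) - 1)) =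
    K * cE Q (fun z => \sum_(j < n) (u j z - 1)).
  by rewrite -cEZ//; apply: eq_cE => z; rewrite mulr_sumr.
rewrite m1.
rewrite -mulrBr -cEB//; last exact: cbounded_measurableB.
rewrite normcM nK mulrA -expr2 -nK -normcX -normcM -cEZ//; last by do ?apply: cbounded_measurableB.
apply: normc_cE_le => [|z].
  by apply: cbounded_measurableM => //; do ?apply: cbounded_measurableB.
rewrite normcM normcX nK; have [_ _ h] := prodB z.
apply: (le_trans (ler_wpM2l (exprn_ge0 2 k0) h)).
rewrite -exprMn ler_sqr ?nnegrE//; last by rewrite mulr_ge0.
by rewrite mulr_ge0// sumr_ge0// => j _; exact: normc_ge0.
Unshelve. all: by end_near. Qed.

End one_sequence.

(** After linearization, the three rescaled increments combine into the mean of a sum of n values of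
    the combined exponent of [power_approx_log], all taken at points of [-C, C], where it is
    uniformly small. *)
Theorem mixed_cf_mul (mu_ nu_ rho_ : nat -> probability R R) (k l r : nat -> nat)
    (F G : R -> R[i]) (p q t : R[i]) :
  power_approx (fun m => cf (mu_ m)) k F -> power_approx (fun m => cf (nu_ m)) l G ->
  power_approx (fun m => cf (rho_ m)) r (fun x => F x * G x) ->
  (forall x, F x != 0) -> (forall x, G x != 0) ->
  cvgc (fun m => mixed_cf (mu_ m) ^+ k m) p -> cvgc (fun m => mixed_cf (nu_ m) ^+ l m) q ->
  cvgc (fun m => mixed_cf (rho_ m) ^+ r m) t -> t = p * q.
Proof.
move=> aF aG aFG F0 G0 hp hq ht.
have FG0 x : F x * G x != 0 by rewrite mulf_neq0.
have [B1 B10 h1] := mixed_cf_linear aF F0.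
have [B2 B20 h2] := mixed_cf_linear aG G0.
have [B3 B30 h3] := mixed_cf_linear aFG FG0.
have koo := power_exponents aF; have loo := power_exponents aG.
have roo := power_exponents aFG.
pose B := B1 + B2 + B3.
have B0 : 0 <= B by rewrite !addr_ge0.
have B1B : B1 <= B by rewrite /B; lra.
have B2B : B2 <= B by rewrite /B; lra.
have B3B : B3 <= B by rewrite /B; lra.
apply: (power_limit_mul (u := fun m => mixed_cf (mu_ m)) (v := fun m => mixed_cf (nu_ m))
  (w := fun m => mixed_cf (rho_ m)) koo loo roo B0) => //;
  try by move=> m; exact: normc_mixed_cf_le1.
- by apply: filterS h1 => m [h _]; exact: le_trans B1B.
- by apply: filterS h2 => m [h _]; exact: le_trans B2B.
- by apply: filterS h3 => m [h _]; exact: le_trans B3B.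
move=> e e0; have e4 : 0 < e / 4 by rewrite divr_gt0.
(* Three quarters of e go to the linearization errors and one to the n values of the combined
   exponent; n + 1 avoids dividing by 0. *)
have e4n : 0 < e / 4 / (n%:R + 1) by rewrite divr_gt0// ltr_wpDl.
have main := power_approx_log aF aG aFG F0 G0 C e4n.
(* Known through its equation only, [lin] is opaque, and the final estimate treats its values as
   plain numbers. *)
have [lin linE] : exists lin : (nat -> probability R R) -> (nat -> nat) -> nat -> R[i],
    forall xi_ kk m, lin xi_ kk m =
      cE Q (fun z => \sum_(j < n) (kk m)%:R * (cf (xi_ m) (s j z) - 1)) by eexists.
have small (kk : nat -> nat) (y : nat -> R) (D : R) : kk @ \oo --> \oo ->
    (\forall m \near \oo, (kk m)%:R * y m <= D ^+ 2) ->
    \forall m \near \oo, y m <= e / 4.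
  move=> kkoo hy; near=> m.
  (* The + 1 ensures that the exponent is positive even when D = 0. *)
  have k1 : D ^+ 2 / (e / 4) + 1 <= (kk m)%:R by near: m; exact: near_nat_ge.
  have k0 : 0 < ((kk m)%:R : R).
    by rewrite (lt_le_trans _ k1)// ltr_wpDl// divr_ge0 ?sqr_ge0// ltW.
  rewrite -(ler_pM2l k0) (@le_trans _ _ (D ^+ 2))//; first by near: m; exact: hy.
  by rewrite -ler_pdivrMr// (le_trans _ k1)// lerDl.
have s1 : \forall m \near \oo, normc ((k m)%:R * (mixed_cf (mu_ m) - 1) - lin mu_ k m) <= e / 4.
  by apply: (small _ _ B1 koo); apply: filterS h1 => m [_]; rewrite linE.
have s2 : \forall m \near \oo, normc ((l m)%:R * (mixed_cf (nu_ m) - 1) - lin nu_ l m) <= e / 4.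
  by apply: (small _ _ B2 loo); apply: filterS h2 => m [_]; rewrite linE.
have s3 : \forall m \near \oo, normc ((r m)%:R * (mixed_cf (rho_ m) - 1) - lin rho_ r m) <= e / 4.
  by apply: (small _ _ B3 roo); apply: filterS h3 => m [_]; rewrite linE.
near=> m; rewrite subr0.
have k1 : normc ((k m)%:R * (mixed_cf (mu_ m) - 1) - lin mu_ k m) <= e / 4.
  by near: m; exact: s1.
have k2 : normc ((l m)%:R * (mixed_cf (nu_ m) - 1) - lin nu_ l m) <= e / 4.
  by near: m; exact: s2.
have k3 : normc ((r m)%:R * (mixed_cf (rho_ m) - 1) - lin rho_ r m) <= e / 4.
  by near: m; exact: s3.
have main_m : forall x, `|x| <= C ->
  normc ((k m)%:R * (cf (mu_ m) x - 1) + (l m)%:R * (cf (nu_ m) x - 1)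
         - (r m)%:R * (cf (rho_ m) x - 1)) <= e / 4 / (n%:R + 1).
  by near: m; exact: main.
have bl (mu : probability R R) (c : R[i]) :
    cbounded_measurable (fun z => \sum_(j < n) c * (cf mu (s j z) - 1)).
  apply: cbounded_measurable_sum => j; apply: cbounded_measurableM.
    exact: cbounded_measurable_cst.
  by apply: cbounded_measurableB;
    [exact: cbounded_measurable_cf_comp|exact: cbounded_measurable_cst].
have k4 : normc (lin mu_ k m + lin nu_ l m - lin rho_ r m) <= e / 4.
  rewrite !linE -(cED Q (bl (mu_ m) (k m)%:R) (bl (nu_ m) (l m)%:R)).
  rewrite -(cEB Q (cbounded_measurableD (bl (mu_ m) (k m)%:R) (bl (nu_ m) (l m)%:R))
    (bl (rho_ m) (r m)%:R)).
  apply: normc_cE_le => [|z].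
    by apply: cbounded_measurableB => //; exact: cbounded_measurableD.
  rewrite -big_split/= -sumrB (le_trans (normc_sum _ _ _))//.
  rewrite (le_trans (ler_sum _ (fun j _ => main_m _ (sC j z))))//.
  rewrite sumr_const card_ord -[leLHS]mulr_natr mulrAC ler_pdivrMr ?ltr_wpDl//.
  by rewrite ler_wpM2l ?(ltW e4)// lerDl.
move: (lin mu_ k m) (lin nu_ l m) (lin rho_ r m) k1 k2 k3 k4 => x1 x2 x3.
set a1 := (k m)%:R * _; set a2 := (l m)%:R * _; set a3 := (r m)%:R * _ => k1 k2 k3 k4.
have -> : a1 + a2 - a3 = (a1 - x1) + (a2 - x2) - (a3 - x3) + (x1 + x2 - x3) by ring.
have t1 := normc_triangle (a1 - x1 + (a2 - x2) - (a3 - x3)) (x1 + x2 - x3).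
have t2 := normc_sub (a1 - x1 + (a2 - x2)) (a3 - x3).
have t3 := normc_triangle (a1 - x1) (a2 - x2).
lra.
Unshelve. all: by end_near. Qed.

End mixed_characters.

(** * Fourier analysis on complex matrices *)

Section matrix_pairing.
Context {R : realType} {n : nat}.
Notation M := 'M[R[i]]_n.
Implicit Types (A B X Y : M).

(* Re Tr (A^* X), the real inner product of complex matrices *)
Definition mxpair A X : R := \sum_(i < n) \sum_(j < n)
  (complex.Re (A i j) * complex.Re (X i j) + complex.Im (A i j) * complex.Im (X i j)).

Lemma mxpairDr A X Y : mxpair A (X + Y) = mxpair A X + mxpair A Y.
Proof.
rewrite /mxpair -big_split; apply: eq_bigr => i _; rewrite -big_split.
apply: eq_bigr => j _; rewrite mxE; case: (A i j) (X i j) (Y i j) => a b [x y] [z t] /=.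
by ring.
Qed.

Lemma mxpairDl A B X : mxpair (A + B) X = mxpair A X + mxpair B X.
Proof.
rewrite /mxpair -big_split; apply: eq_bigr => i _; rewrite -big_split.
apply: eq_bigr => j _; rewrite mxE; case: (A i j) (B i j) (X i j) => a b [x y] [z t] /=.
by ring.
Qed.

Lemma mxpairZl (c : R) A X : mxpair (c%:C *: A) X = c * mxpair A X.
Proof.
rewrite /mxpair mulr_sumr; apply: eq_bigr => i _; rewrite mulr_sumr.
apply: eq_bigr => j _; rewrite mxE; case: (A i j) (X i j) => a b [x y] /=.
by ring.
Qed.

Lemma mxpairZr (c : R) A X : mxpair A (c%:C *: X) = c * mxpair A X.
Proof.
rewrite /mxpair mulr_sumr; apply: eq_bigr => i _; rewrite mulr_sumr.
apply: eq_bigr => j _; rewrite mxE; case: (A i j) (X i j) => a b [x y] /=.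
by ring.
Qed.

Lemma mxpair0l X : mxpair 0 X = 0.
Proof. by rewrite -(scale0r 0) -(rmorph0 (real_complex R)) mxpairZl mul0r. Qed.

Lemma mxpair0r A : mxpair A 0 = 0.
Proof. by rewrite -(scale0r 0) -(rmorph0 (real_complex R)) mxpairZr mul0r. Qed.

Lemma mxpair_sumr A (I : Type) (s : seq I) (X : I -> M) :
  mxpair A (\sum_(i <- s) X i) = \sum_(i <- s) mxpair A (X i).
Proof.
by elim/big_ind2 : _ => [|x y z t <- <-|//]; rewrite ?mxpair0r ?mxpairDr.
Qed.

(** With c = 1 and c = i, this exhibits the real and imaginary parts of the entries as values of the
    pairing. *)
Lemma mxpair_delta (c : R[i]) (i j : 'I_n) X : mxpair (c *: delta_mx i j) X =
  complex.Re c * complex.Re (X i j) + complex.Im c * complex.Im (X i j).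
Proof.
rewrite /mxpair (bigD1 i)//= (bigD1 j)//= !mxE !eqxx mulr1.
rewrite big1 ?addr0 => [|j' /negbTE jj']; last first.
  by rewrite !mxE eqxx jj' mulr0 !mul0r addr0.
rewrite big1 ?addr0 => [//|i' /negbTE ii']; rewrite big1// => j' _.
by rewrite !mxE ii' mulr0 !mul0r addr0.
Qed.

Definition mxpair_bound A : R := \sum_(i < n) \sum_(j < n)
  (`|complex.Re (A i j)| + `|complex.Im (A i j)|).

Lemma normr_mxpair_le A X : (forall i j, normc (X i j) <= 1) ->
  `|mxpair A X| <= mxpair_bound A.
Proof.
move=> X1; rewrite (le_trans (ler_norm_sum _ _ _))// ler_sum// => i _.
rewrite (le_trans (ler_norm_sum _ _ _))// ler_sum// => j _.
rewrite (le_trans (ler_normD _ _))// !normrM lerD// ler_piMr//.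
  exact: le_trans (ler_Re_normc _) (X1 i j).
exact: le_trans (ler_Im_normc _) (X1 i j).
Qed.

Lemma measurable_mxpair d (T : measurableType d) (f : T -> M) A :
  (forall i j, cmeasurable (fun x => f x i j)) ->
  measurable_fun [set: T] (fun x => mxpair A (f x)).
Proof.
move=> mf; apply: measurable_sum => i; apply: measurable_sum => j.
have [mRe mIm] := mf i j.
by apply: measurable_funD; apply: measurable_funM => //; exact: measurable_cst.
Qed.

Lemma continuous_coord (g : R[i] -> R) (i j : 'I_n) :
  (forall z w, `|g z - g w| <= normc (z - w)) ->
  continuous (fun X : M => g (X i j)).
Proof.
move=> lg X; apply/(cvgrPdist_lt (F := nbhs X)) => e e0.
apply/nbhs_ballP; exists e%:C => /=; first by rewrite ltcR.
move=> Y [_ /(_ i j)]; rewrite /ball /= normc_def ltcR => XY.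
apply: le_lt_trans (lg _ _) _; apply: le_lt_trans XY.
by case: (X i j - Y i j).
Qed.

Lemma continuous_mxpair A : continuous (mxpair A).
Proof.
apply: continuous_big => [|i _]; first exact: add_continuous.
apply: continuous_big => [|j _]; first exact: add_continuous.

move=> X; apply: (@cvgD _ _ _ (nbhs X) (nbhs_filter X)).
  apply: (@cvgM _ _ (nbhs X) (nbhs_filter X)); first
    exact: (@cvg_cst _ _ _ (nbhs X) (nbhs_filter X)).
  apply: (@continuous_coord (@complex.Re R)) => z w.
  by rewrite (le_trans _ (ler_Re_normc _))//; case: z w => ? ? [].
apply: (@cvgM _ _ (nbhs X) (nbhs_filter X)); first
    exact: (@cvg_cst _ _ _ (nbhs X) (nbhs_filter X)).
apply: (@continuous_coord (@complex.Im R)) => z w.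
by rewrite (le_trans _ (ler_Im_normc _))//; case: z w => ? ? [].
Qed.

Definition mxchar A X : R[i] := eit (mxpair A X).

Lemma cbounded_measurable_mxchar A : cbounded_measurable (mxchar A).
Proof.
apply: cbounded_measurable_eit; apply: (@measurable_mxpair _ _ id) => i j.
exact: cmeasurable_coord.
Qed.

Lemma cE_convM_pow (mu : probability M R) A m :
  cE (convM_pow mu m) (mxchar A) = cE mu (mxchar A) ^+ m.
Proof.
apply: cE_convolution_pow; first exact: cbounded_measurable_mxchar.
  by rewrite /mxchar mxpair0r eit0.
by move=> p; rewrite /mxchar mxpairDr eitD.
Qed.

Lemma cE_convM (mu nu : probability M R) A :
  cE (convM mu nu) (mxchar A) = cE mu (mxchar A) * cE nu (mxchar A).
Proof.
apply: cE_convolution; first exact: cbounded_measurable_mxchar.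
by move=> p; rewrite /mxchar mxpairDr eitD.
Qed.

(** Orthants cut out by finitely many real linear forms: a class closed under intersection on which
    [eq_probability_lt] applies. *)
Definition mxbox (ab : 'M[R]_n * 'M[R]_n) : set M :=
  [set X | forall i j, complex.Re (X i j) < ab.1 i j /\ complex.Im (X i j) < ab.2 i j].

Definition mxboxes : set (set M) := range mxbox.

(** For the first inclusion, the identity is measurable from the sigma-algebra of the boxes, because
    a half-space on one coordinate is a countable union of boxes whose other bounds tend to
    infinity. *)
Lemma measurable_cmx_boxes : @measurable _ M = <<s mxboxes >>.
Proof.
apply/seteqP; split.
  pose T := g_sigma_algebraType mxboxes.
  suff mid : measurable_fun [set: T] (id : T -> M).
    by move=> B mB; have := mid measurableT B mB; rewrite setTI.
  apply: measurable_cmx => i j.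
  pose up (k : nat) : 'M[R]_n := const_mx k.+1%:R.
  have big X : exists k : nat, forall i j, complex.Re (X i j) < k.+1%:R /\
      complex.Im (X i j) < k.+1%:R.
    exists (Num.truncn (\sum_i \sum_j normc ((X : M) i j))) => i' j'.
    have h : normc (X i' j') < (Num.truncn (\sum_i \sum_j normc (X i j))).+1%:R.
      apply: le_lt_trans (truncnS_gt _).
      rewrite (bigD1 i')//= (bigD1 j')//= -addrA lerDl addr_ge0//.
        by rewrite sumr_ge0// => ? _; exact: normc_ge0.
      by rewrite sumr_ge0// => ? _; rewrite sumr_ge0// => ? _; exact: normc_ge0.
    by split; apply: le_lt_trans h; rewrite (le_trans (ler_norm _))// ?ler_Re_normc ?ler_Im_normc.
  pose cut k (c : R) : 'M[R]_n := \matrix_(i', j') if (i' == i) && (j' == j) then c else k.+1%:R.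
  split; apply: (measurability _ (RGenInftyO.measurableE R)) => // _ [_ [c ->] <-].
    rewrite setTI (_ : _ @^-1` _ = \bigcup_k mxbox (cut k c, up k)).
      by apply: bigcupT_measurable => k; apply: sub_sigma_algebra; exists (cut k c, up k).
    apply/seteqP; split => [X /=|X [k _ /(_ i j)] /=]; rewrite in_itv/=.
      move=> Xc; have [k kX] := big X; exists k => // i' j'; rewrite !mxE.
      by case: ifPn => [/andP[/eqP -> /eqP ->]|_]; split=> //;
        exact: (kX _ _).1 || exact: (kX _ _).2.
    by rewrite mxE !eqxx => -[].
  rewrite setTI (_ : _ @^-1` _ = \bigcup_k mxbox (up k, cut k c)).
    by apply: bigcupT_measurable => k; apply: sub_sigma_algebra; exists (up k, cut k c).
  apply/seteqP; split => [X /=|X [k _ /(_ i j)] /=]; rewrite in_itv/=.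
    move=> Xc; have [k kX] := big X; exists k => // i' j'; rewrite !mxE.
    by case: ifPn => [/andP[/eqP -> /eqP ->]|_]; split=> //;
        exact: (kX _ _).1 || exact: (kX _ _).2.
  by rewrite [in X in _ /\ X]mxE !eqxx => -[].
apply: smallest_sub; first exact: sigma_algebra_measurable.
move=> _ [ab _ <-].
have mlt (g : M -> R) (c : R) : measurable_fun [set: M] g -> measurable [set X | g X < c].
  move=> mg; rewrite (_ : [set X | _] = setT `&` g @^-1` [set` `]-oo, c[]); last first.
    by rewrite setTI; apply/seteqP; split => x /=; rewrite in_itv.
  by apply: mg => //; exact: measurable_itv.
rewrite (_ : mxbox ab = \bigcap_(i : 'I_n) \bigcap_(j : 'I_n)
     ([set X | complex.Re (X i j) < ab.1 i j] `&`
      [set X | complex.Im (X i j) < ab.2 i j])); last first.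
  apply/seteqP; split => [x bx i _ j _|x bx i j]; first exact: bx.
  exact: (bx i I j I).
apply: fin_bigcap_measurable => // i _; apply: fin_bigcap_measurable => // j _.
have [mRe mIm] := @cmeasurable_coord R n i j.
by apply: measurableI; exact: mlt.
Qed.

(** The boxes form a generating class closed under intersection, and an increasing sequence of them
    covers the space; so agreement on boxes is enough. *)
Theorem mxchar_injective (P Q : probability M R) :
  (forall A, cE P (mxchar A) = cE Q (mxchar A)) -> measure_eq P Q.
Proof.
move=> PQ; pose Lin : set (M -> R) := range mxpair.
have measurable_Lin f : Lin f -> measurable_fun [set: M] f.
  by move=> [A _ <-]; apply: (@measurable_mxpair _ _ id) => i j; exact: cmeasurable_coord.
have LinD f g : Lin f -> Lin g -> Lin (fun X => f X + g X).
  by move=> [A _ <-] [B _ <-]; exists (A + B) => //; apply/funext => X; exact: mxpairDl.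
have LinZ (c : R) f : Lin f -> Lin (fun X => c * f X).
  by move=> [A _ <-]; exists (c%:C *: A) => //; apply/funext => X; exact: mxpairZl.
have Lin0 : Lin (fun=> 0) by exists 0 => //; apply/funext => X; exact: mxpair0l.
have LinPQ f : Lin f -> cE P (fun x => eit (f x)) = cE Q (fun x => eit (f x)).
  by move=> [A _ <-]; exact: PQ.
have boxPQ ab : P (mxbox ab) = Q (mxbox ab).
  (* The 2 n^2 real coordinates are indexed by an entry and a boolean, true for the imaginary
     part. *)
  pose f (k : 'I_n * 'I_n * bool) (X : M) : R :=
    if k.2 then complex.Im (X k.1.1 k.1.2) else complex.Re (X k.1.1 k.1.2).
  pose a (k : 'I_n * 'I_n * bool) : R :=
    if k.2 then ab.2 k.1.1 k.1.2 else ab.1 k.1.1 k.1.2.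
  have -> : mxbox ab = [set X | forall k, f k X < a k].
    apply/seteqP; split => X h.
      by move=> [[i j] []]; rewrite /f /a /=; have [] := h i j.
    by move=> i j; split; [exact: (h (i, j, false))|exact: (h (i, j, true))].
  apply: (@eq_probability_lt _ _ _ P Q Lin LinD LinZ measurable_Lin LinPQ _ f a Lin0) => -[[i j] b].
  exists ((if b then 'i%C else 1) *: delta_mx i j) => //; apply/funext => X.
  by rewrite mxpair_delta /f /=; case: b => /=; rewrite mul0r mul1r ?addr0 ?add0r.
move=> A mA; apply: (measure_unique mxboxes
  (fun k : nat => mxbox (const_mx k%:R, const_mx k%:R)) measurable_cmx_boxes) => //.
- move=> _ _ [[a1 b1] _ <-] [[a2 b2] _ <-].
  exists (\matrix_(i, j) Num.min (a1 i j) (a2 i j), \matrix_(i, j) Num.min (b1 i j) (b2 i j)) => //.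
  apply/seteqP; split => [X h|X [h1 h2] i j].
    by split=> i j; have := h i j; rewrite /= !mxE !lt_min => -[/andP[? ?] /andP[? ?]].
  by have [] := h1 i j; have [] := h2 i j; rewrite /= !mxE !lt_min => -> -> -> ->.
- by move=> k; exists (const_mx k%:R, const_mx k%:R).
- apply/seteqP; split=> // X _.
  exists (Num.truncn (\sum_i \sum_j normc (X i j))).+1 => // i j; rewrite /= !mxE.
  have h : normc (X i j) < (Num.truncn (\sum_i \sum_j normc (X i j))).+1%:R.
    apply: le_lt_trans (truncnS_gt _).
    rewrite (bigD1 i)//= (bigD1 j)//= -addrA lerDl addr_ge0//.
      by rewrite sumr_ge0// => ? _; exact: normc_ge0.
    by rewrite sumr_ge0// => ? _; rewrite sumr_ge0// => ? _; exact: normc_ge0.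
  by split; apply: le_lt_trans h; rewrite (le_trans (ler_norm _))// ?ler_Re_normc ?ler_Im_normc.
- by move=> _ [ab _ <-]; exact: boxPQ.
- move=> k; apply: (@le_lt_trans _ _ (P setT)); last by rewrite probability_setT ltry.
  by apply: le_measure; rewrite ?inE// measurable_cmx_boxes;
    apply: sub_sigma_algebra; exists (const_mx k%:R, const_mx k%:R).
Qed.

End matrix_pairing.

(** * Laws of U diag(X) V and their limits *)

Section random_matrix_laws.
Context {d : measure_display} {Z : measurableType d} {R : realType} {n : nat}.
Notation M := 'M[R[i]]_n.
Variables (Q : probability Z R) (U V : Z -> M) (S : set Z).
Hypotheses (mU : measurable_fun [set: Z] U) (mV : measurable_fun [set: Z] V).
Hypotheses (mS : measurable S) (QS : Q S = 1%E).
Hypothesis U1 : forall z, S z -> forall i j, normc (U z i j) <= 1.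
Hypothesis V1 : forall z, S z -> forall i j, normc (V z i j) <= 1.

(** The pairing of A with the rank-one matrix formed by column k of U and row k of V: the
    coefficient of x_k in the pairing of A with U diag(x) V. For V = U^* and A Hermitian, it is <u,
    A u> with u the k-th column. Keeping [Z], [U] and [V] abstract treats both ensembles at once. *)
Definition diag_weight (A : M) (k : 'I_n) (z : Z) : R :=
  mxpair A (\matrix_(i, j) (U z i k * V z k j)).

Lemma mxpair_mul_diag (A : M) (z : Z) (x : n.-tuple R) :
  mxpair A (U z *m real_diag x *m V z) = \sum_(k < n) diag_weight A k z * tnth x k.
Proof.
have -> : U z *m real_diag x *m V z =
    \sum_(k < n) ((tnth x k)%:C *: \matrix_(i, j) (U z i k * V z k j)).
  rewrite /real_diag mul_mx_diag; apply/matrixP => i j.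
  rewrite summxE mxE; apply: eq_bigr => k _.
  by rewrite !mxE mulrCA mulrA.
by rewrite mxpair_sumr; apply: eq_bigr => k _; rewrite mxpairZr mulrC.
Qed.

Lemma measurable_diag_weight A k : measurable_fun [set: Z] (diag_weight A k).
Proof.
apply: measurable_mxpair => i j; under eq_fun do rewrite mxE.
by apply: cmeasurableM; exact: cmeasurable_comp.
Qed.

Lemma cE_mul_diag (A : M) (mu : probability R R) :
  cbounded_measurable (fun p : Z * n.-tuple R =>
    mxchar A (U p.1 *m real_diag p.2 *m V p.1)) ->
  cE (Q \x iid_law mu n)%E
    (fun p => mxchar A (U p.1 *m real_diag p.2 *m V p.1)) =
  mixed_cf Q (diag_weight A) mu.
Proof.
move=> bf; rewrite (cE_product _ _ bf).2; apply: eq_cE => z.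
rewrite -(cE_iid_law mu (fun k => diag_weight A k z)); apply: eq_cE => x /=.
by rewrite /mxchar mxpair_mul_diag.
Qed.

(* The weights are bounded on S only; truncating them off this set of full
   measure makes them bounded everywhere. *)
Definition clamp (C x : R) : R := Num.max (- C) (Num.min C x).

Lemma mixed_cf_clamp A (mu : probability R R) : mixed_cf Q (diag_weight A) mu =
  mixed_cf Q (fun k z => clamp (mxpair_bound A) (diag_weight A k z)) mu.
Proof.
have mc k : measurable_fun [set: Z] (fun z => clamp (mxpair_bound A) (diag_weight A k z)).
  apply: measurable_maxr; first exact: measurable_cst.
  apply: measurable_minr; first exact: measurable_cst.
  exact: measurable_diag_weight.
apply: (cE_eq_on mS QS).
- by apply: (cbounded_measurable_prod_cf Q) => k; exact: measurable_diag_weight.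
- exact: (cbounded_measurable_prod_cf Q).
move=> z Sz; apply: eq_bigr => k _; congr (cf mu _).
have : `|diag_weight A k z| <= mxpair_bound A.
  apply: normr_mxpair_le => i j; rewrite mxE normcM mulr_ile1 ?normc_ge0//.
    exact: U1.
  exact: V1.
by rewrite ler_norml /clamp => /andP[h1 h2]; rewrite min_r// max_r.
Qed.

Variable law : probability R R -> probability M R.
Hypothesis lawE : forall mu A, cE (law mu) (mxchar A) = mixed_cf Q (diag_weight A) mu.

(** Characters are bounded and continuous, so each limit law has as transform at A the limit of the
    powers of [mixed_cf]; multiplicativity of these limits at every A identifies the measures. *)
Theorem matrix_limit_convolution (mu nu : probability R R) (P_mu P_nu P_mu_nu : probability M R) :
  infinitely_divisible mu -> infinitely_divisible nu ->
  is_matrix_limit law mu P_mu -> is_matrix_limit law nu P_nu ->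
  is_matrix_limit law (convR mu nu) P_mu_nu ->
  measure_eq P_mu_nu (convM P_mu P_nu).
Proof.
move=> mu_id nu_id [mu_ [k [koo wmu wPmu]]] [nu_ [l [loo wnu wPnu]]].
move=> [rho_ [r [roo wrho wPrho]]]; apply: mxchar_injective => A; rewrite cE_convM.
pose s k z := clamp (mxpair_bound A) (diag_weight A k z).
have ms j : measurable_fun [set: Z] (s j).
  apply: measurable_maxr; first exact: measurable_cst.
  apply: measurable_minr; first exact: measurable_cst.
  exact: measurable_diag_weight.
have C0 : 0 <= mxpair_bound A by rewrite !sumr_ge0// => i _; rewrite sumr_ge0.
have sC j z : `|s j z| <= mxpair_bound A.
  rewrite ler_norml le_max lexx/= ge_max ge_min lexx/= andbT.
  by rewrite (le_trans _ C0)// oppr_le0.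
have lim (xi_ : nat -> probability R R) (kk : nat -> nat) (P : probability M R) :
    weakly_converges (fun m => convM_pow (law (xi_ m)) (kk m)) P ->
    cvgc (fun m => mixed_cf Q s (xi_ m) ^+ kk m) (cE P (mxchar A)).
  move=> wP; have -> : (fun m => mixed_cf Q s (xi_ m) ^+ kk m) =
      fun m => cE (convM_pow (law (xi_ m)) (kk m)) (mxchar A).
    by apply/funext => m; rewrite cE_convM_pow lawE mixed_cf_clamp.
  apply: weakly_converges_cE => //; last exact: cbounded_measurable_mxchar.
    move=> X; apply: (@continuous_comp _ _ _ (mxpair A) cos); first exact: continuous_mxpair.
    exact: continuous_cos.
  move=> X; apply: (@continuous_comp _ _ _ (mxpair A) sin); first exact: continuous_mxpair.
  exact: continuous_sin.
have rho_approx : power_approx (fun m => cf (rho_ m)) r (fun t => cf mu t * cf nu t).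
  have := power_approx_cf roo wrho.
  by congr power_approx; apply/funext => t; rewrite cf_convR.
apply: (mixed_cf_mul ms sC (power_approx_cf koo wmu) (power_approx_cf loo wnu) rho_approx
  (cf_neq0 mu_id) (cf_neq0 nu_id)).
- exact: lim wPmu.
- exact: lim wPnu.
- exact: lim wPrho.
Qed.

End random_matrix_laws.

(** * Unitary matrices and the two ensembles *)

Section unitary_matrices.
Context {R : realType} {n : nat}.
Notation M := 'M[R[i]]_n.

(** The diagonal entries of U U^* say that the squared moduli in a row of U sum to 1. *)
Lemma normc_unitary_le1 (U : M) i j : U \is unitarymx -> normc (U i j) <= 1.
Proof.
move=> /unitarymxP/matrixP/(_ i i); rewrite !mxE eqxx => /(congr1 (@complex.Re R)).
rewrite (_ : complex.Re _ = \sum_(k < n) normc (U i k) ^+ 2); last first.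
  have ReD : {morph @complex.Re R : z w / z + w >-> z + w} by case=> ? ? [].
  rewrite (big_morph _ ReD (erefl : complex.Re (0 : R[i]) = 0)); apply: eq_bigr => k _.
  by rewrite !mxE sqr_normcE; case: (U i k) => a b /=; ring.
rewrite (bigD1 j)//= => h; rewrite -(@expr_le1 _ 2) ?normc_ge0// -h lerDl.
by rewrite sumr_ge0// => k _; exact: sqr_ge0.
Qed.

Lemma measurable_unitary : measurable [set U : M | U \is unitarymx].
Proof.
pose f (U : M) : M := U *m U^t*.
have mf : measurable_fun [set: M] f.
  by apply: measurable_mulmx => //; exact: measurable_adjoint.
have mlevel (g : M -> R) (c : R) : measurable_fun [set: M] g -> measurable [set X | g X = c].
  move=> mg; rewrite (_ : [set X | _] = setT `&` g @^-1` [set c]); last by rewrite setTI.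
  by apply: mg.
rewrite (_ : [set U | _] = \bigcap_(i : 'I_n) \bigcap_(j : 'I_n)
     ([set U | complex.Re (f U i j) = complex.Re ((1%:M : M) i j)] `&`
      [set U | complex.Im (f U i j) = complex.Im ((1%:M : M) i j)])).
  apply: fin_bigcap_measurable => // i _; apply: fin_bigcap_measurable => // j _.
  have [mRe mIm] := cmeasurable_comp i j mf.
  by apply: measurableI; exact: mlevel.
apply/seteqP; split => [U /unitarymxP fU i _ j _|U fU]; first by rewrite /f /= fU.
apply/unitarymxP/matrixP => i j; apply/eqP; rewrite eq_complex.
by have [/= -> ->] := fU i I j I; rewrite !eqxx.
Qed.

End unitary_matrices.

Theorem mainTheorem6 (R : realType) (d : nat) (d_ge1 : (1 <= d)%N)
    (H : probability 'M[R[i]]_d R) (haarH : haar_unitary H)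
    (mu nu : probability R R)
    (mu_id : infinitely_divisible mu) (nu_id : infinitely_divisible nu) :
  (forall P_mu P_nu P_mu_nu : probability 'M[R[i]]_d R,
     is_P_law H mu P_mu -> is_P_law H nu P_nu ->
     is_P_law H (convR mu nu) P_mu_nu ->
     measure_eq P_mu_nu (convM P_mu P_nu)) /\
  (forall L_mu L_nu L_mu_nu : probability 'M[R[i]]_d R,
     is_L_law H mu L_mu -> is_L_law H nu L_nu ->
     is_L_law H (convR mu nu) L_mu_nu ->
     measure_eq L_mu_nu (convM L_mu L_nu)).
Proof.
have [HU _] := haarH; have mUn := @measurable_unitary R d.
split=> [P_mu P_nu P_mu_nu|L_mu L_nu L_mu_nu].
  (* The sample is one unitary matrix, the right factor being its adjoint. *)
  have m1 : measurable_fun [set: 'M[R[i]]_d] (id : 'M[R[i]]_d -> 'M[R[i]]_d) by [].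
  have m2 := measurable_adjoint m1.
  apply: (matrix_limit_convolution m1 m2 mUn HU) => //.
  - by move=> U Uu i j; exact: normc_unitary_le1.
  - move=> U Uu i j; rewrite !mxE (_ : normc _ = normc (U j i)).
      exact: normc_unitary_le1.
    by case: (U j i) => a b /=; rewrite sqrrN.
  - move=> xi A.
    have bc : cbounded_measurable (fun p => mxchar A (@conj_diag R d p)).
      by apply: cbounded_measurable_comp => //; exact: cbounded_measurable_mxchar.
    rewrite /conj_diag_law cE_distribution; last exact: cbounded_measurable_mxchar.
    exact: (@cE_mul_diag _ _ _ _ H id (fun U => U^t*) A xi bc).
(* The sample is a pair of independent matrices, and the set of full measure is the square of the
   set of unitary matrices. *)
have m1 : measurable_fun [set: 'M[R[i]]_d * 'M[R[i]]_d] fst by exact: measurable_fst.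
have m2 : measurable_fun [set: 'M[R[i]]_d * 'M[R[i]]_d] snd by exact: measurable_snd.
have HHU : (H \x H)%E ([set U | U \is unitarymx] `*` [set U | U \is unitarymx]) = 1%E.
  by rewrite product_measure1E// [X in (X * _)%E]HU [X in (_ * X)%E]HU mule1.
apply: (matrix_limit_convolution m1 m2 (measurableX mUn mUn) HHU) => //.
- by move=> -[U V] [/= Uu _] i j; exact: normc_unitary_le1.
- by move=> -[U V] [/= _ Vu] i j; exact: normc_unitary_le1.
- move=> xi A.
  have bc : cbounded_measurable (fun p => mxchar A (@biunitary_diag R d p)).
    by apply: cbounded_measurable_comp => //; exact: cbounded_measurable_mxchar.
  rewrite /biunitary_diag_law cE_distribution; last exact: cbounded_measurable_mxchar.
  exact: (@cE_mul_diag _ _ _ _ (H \x H)%E fst snd A xi bc).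
Qed.
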